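(* Let $\alpha$ be a countable ordinal, let $\mathcal G_0$ be a reasonable class of linear orderings, and let $\mathcal G$ be the class of $\alpha$-FAC posets all of whose chains belong to $\mathcal G_0$. Assume moreover that (1) $\mathcal G_0$ contains all well-orderings and is closed under lexicographic sums with index set in $\mathcal G_0$, and (2) $\mathcal G$ is closed under augmentations. Then $\mathcal G=\alpha cl(\mathcal G_0)$.
   Context: A poset is FAC if all its antichains are finite. A barrier is an infinite set $B\subseteq[\omega]^{<\omega}$ which is an antichain under $\subseteq$ and such that every infinite subset of $\bigcup B$ has an initial segment in $B$; its type is its order type under the lexicographic order. For nonempty finite $r,s$, $r\triangleleft s$ means $\min r<\min s$ and $r\setminus\{\min r\}$ is a proper initial segment of $s$. $P$ is $\alpha$-wqo iff for every barrier $B$ of type $\le\alpha$ and every $f:B\to P$ there are $s\triangleleft t$ in $B$ with $f(s)\le f(t)$. A poset $(Q,\le_Q)$ is an augmentation of $(P,\le_P)$ if they have the same domain and $\le_P\subseteq\le_Q$. Lexicographic sum of posets $X_j$ along an index poset $J$: disjoint union with $x\le y$ iff $x,y\in X_j$ and $x\le_{X_j}y$, or $x\in X_j$, $y\in X_k$ with $j<_J k$. A FAC poset $P$ is $\alpha$-FAC if there exist an ordinal $\zeta$, $p_\beta\in P$ and $Z_\beta\subseteq P$ ($\beta<\zeta$) with: $\{p_\beta:\beta<\zeta\}$ $\alpha$-wqo; each $Z_\beta$ convex with maximum $p_\beta$, the $Z_\beta$ partitioning $P$; and $P$ an augmentation of the lexicographic sum of the $Z_\beta$ along $(\zeta,\preceq)$,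 $\beta\preceq\gamma$ iff $p_\beta\le p_\gamma$. A class of linear orderings is reasonable if it contains a nonempty ordering and is closed under reversals and restrictions. $\alpha cl(\mathcal G_0)$ is the least class of posets containing $\mathcal G_0$ and closed under lexicographic sums with index set an $\alpha$-wqo poset, the reverse of an $\alpha$-wqo poset, or an element of $\mathcal G_0$, and under augmentations.
   Formalization: The countable ordinal α is taken to be infinite: for finite α no barrier has type ≤ α, so every poset is α-wqo and αcl(G_0) contains an infinite antichain, which is not FAC, and the equality fails (e.g. G_0 all linear orderings). *)

(* Defs.v *)
From mathcomp Require Import all_boot all_order.
From mathcomp Require Import boolp classical_sets cardinality wochoice.

Set Implicit Arguments.
Unset Strict Implicit.
Unset Printing Implicit Defensive.

Local Open Scope classical_set_scope.

(* An order on T is its large relation r : rel T.  The predicates               *)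
(* partial_order, total_order, well_order and maximum_of are those of           *)
(* wochoice; well_order (every nonempty subset has a unique minimum) entails    *)
(* total_order.  An ordinal is given as a well-ordered type.                    *)

Definition restr T (r : rel T) (A : set T) : rel A := relpre val r.
Arguments restr {T} r A.

Definition reversal T (r : rel T) : rel T := fun x y => r y x.

Definition order_iso T T' (r : rel T) (r' : rel T') : Prop :=
  exists2 f : T -> T', bijective f & {mono f : x y / r x y >-> r' x y}.

(* For well-orders, inequality of the ordinals. *)
Definition otype_le T T' (r : rel T) (r' : rel T') : Prop :=
  exists2 f : T -> T', {mono f : x y / r x y >-> r' x y} &
    forall x y', r' y' (f x) -> exists y, f y = y'.

Definition augments T (r r' : rel T) : Prop := forall x y, r x y -> r' x y.

Definition lexsum J (rJ : rel J) (X : J -> Type) (rX : forall j, rel (X j)) :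
    rel {j : J & X j} :=
  fun u v => `[< (exists j (x y : X j),
                    [/\ u = existT X j x, v = existT X j y & rX j x y])
                 \/ (rJ (tag u) (tag v) /\ tag u <> tag v) >].

(* A finite subset of nat is represented by its strictly increasing             *)
(* enumeration, a sequence s with sorted ltn s.                                 *)

Definition initial_segment (s : seq nat) (X : set nat) : Prop :=
  (forall n, n \in s -> X n) /\
  (forall m n, X m -> n \in s -> m <= n -> m \in s).

Record barrier (B : set (seq nat)) : Prop := Barrier {
  barrier_sorted : forall s, B s -> sorted ltn s;
  barrier_infinite : infinite_set B;
  barrier_antichain : forall s t, B s -> B t -> {subset s <= t} -> s = t;
  barrier_bar : forall X : set nat, infinite_set X ->
    X `<=` [set n | exists2 s, B s & n \in s] ->
    exists2 s, B s & initial_segment s X }.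

Definition lexle : rel (seq nat) :=
  fun s t => ((s : seqlexi nat) <= (t : seqlexi nat))%O.

Definition triangle (s t : seq nat) : bool :=
  match s, t with
  | m :: s', n :: _ => [&& m < n, prefix s' t & s' != t]
  | _, _ => false
  end.

Definition alpha_wqo A (rA : rel A) T (r : rel T) : Prop :=
  forall B : set (seq nat), barrier B -> otype_le (restr lexle B) rA ->
  forall f : B -> T,
  exists s t : B, triangle (val s) (val t) /\ r (f s) (f t).

Definition FAC T (r : rel T) : Prop :=
  forall C : set T, (forall x y, C x -> C y -> r x y -> x = y) -> finite_set C.

Definition convex T (r : rel T) (C : set T) : Prop :=
  forall x y z, C x -> C z -> r x y -> r y z -> C y.

(* Since the Z b partition T, the underlying set of their sum is identified     *)
(* with T through the bijection u |-> val (tagged u).                           *)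
Definition alpha_FAC A (rA : rel A) T (r : rel T) : Prop :=
  FAC r /\
  exists (zeta : Type) (rzeta : rel zeta) (p : zeta -> T) (Z : zeta -> set T),
    well_order rzeta /\
    alpha_wqo rA (restr r (range p)) /\
    (forall b, convex r (Z b) /\ maximum_of r (mem (Z b)) (p b)) /\
    (forall x, exists! b, Z b x) /\
    (forall u v : {b : zeta & Z b},
       lexsum (relpre p r) (fun b => restr r (Z b)) u v ->
       r (val (tagged u)) (val (tagged v))).

Definition order_class := forall T : Type, rel T -> Prop.

(* A class of orderings is understood to be closed under isomorphism. *)
Record linear_class (G0 : order_class) : Prop := LinearClass {
  linear_class_total : forall T (r : rel T), G0 T r -> total_order r;
  linear_class_iso : forall T T' (r : rel T) (r' : rel T'),
    order_iso r r' -> G0 T r -> G0 T' r' }.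

Record reasonable (G0 : order_class) : Prop := Reasonable {
  reasonable_linear : linear_class G0;
  reasonable_nonempty : exists (T : Type) (r : rel T), G0 T r /\ inhabited T;
  reasonable_reversal : forall T (r : rel T), G0 T r -> G0 T (reversal r);
  reasonable_restr : forall T (r : rel T) (C : set T),
    G0 T r -> G0 C (restr r C) }.

Definition closed_under_sums (G0 : order_class) : Prop :=
  forall J (rJ : rel J) (X : J -> Type) (rX : forall j, rel (X j)),
    G0 J rJ -> (forall j, G0 (X j) (rX j)) -> G0 {j : J & X j} (lexsum rJ rX).

Definition closed_under_augmentations (G : order_class) : Prop :=
  forall T (r r' : rel T),
    G T r -> partial_order r' -> augments r r' -> G T r'.

Definition alpha_FAC_chains A (rA : rel A) (G0 : order_class) : order_class :=
  fun T r => [/\ partial_order r, alpha_FAC rA r &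
    forall C : set T, {in C &, total r} -> G0 C (restr r C)].

Inductive alpha_cl A (rA : rel A) (G0 : order_class) : order_class :=
| alpha_cl_base T (r : rel T) : G0 T r -> alpha_cl rA G0 r
| alpha_cl_iso T T' (r : rel T) (r' : rel T') :
    order_iso r r' -> alpha_cl rA G0 r -> alpha_cl rA G0 r'
| alpha_cl_sum J (rJ : rel J) (X : J -> Type) (rX : forall j, rel (X j)) :
    [\/ partial_order rJ /\ alpha_wqo rA rJ,
        partial_order rJ /\ alpha_wqo rA (reversal rJ) |
        G0 J rJ] ->
    (forall j, alpha_cl rA G0 (rX j)) ->
    alpha_cl rA G0 (lexsum rJ rX)
| alpha_cl_augm T (r r' : rel T) :
    alpha_cl rA G0 r -> partial_order r' -> augments r r' ->
    alpha_cl rA G0 r'.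

(* Main.v *)
Require Import Defs.
From mathcomp Require Import all_boot all_order.
From mathcomp Require Import boolp classical_sets cardinality wochoice.
From mathcomp Require Import functions filter.

(* For fixed alpha there are two cases.

   If some wqo poset R is not alpha-wqo, then the class of alpha-FAC posets is not
   closed under augmentations, so the hypotheses are contradictory.  We may take the
   principal lower sections of R to be alpha-wqo.  Let X_n consist of two incomparable
   copies of R below a maximum p_n, and order the blocks by X_i < X_j iff i + 2 <= j.
   This sum is alpha-FAC, but adding p_i < p_j for all i < j destroys the property:
   a decomposition would have to keep a large part of X_n together with p_n, while
   X_n and X_(n+1) are incomparable.

   If every wqo poset is alpha-wqo, then alpha-FAC means FAC.  Indeed every FAC poset
   has a decomposition along a well-founded set of maxima: take a maximal partial
   decomposition of an initial section; if it is not total, a bad sequence of maxima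
   appears.  Applying this upwards and downwards, a FAC poset is in the closure as
   soon as all its intervals are.  By induction along the sets of elements
   incomparable to a given one, it remains to compare an arbitrary FAC poset with a
   maximal chain, condensed by the relation "the interval between the two points is
   in the closure". *)

Set Implicit Arguments.
Unset Strict Implicit.
Unset Printing Implicit Defensive.

Local Open Scope classical_set_scope.

Lemma dependent_choice_in (X : Type) (P : X -> Prop) (R : X -> X -> Prop) x0 :
  P x0 -> (forall x, P x -> exists2 y, P y & R x y) ->
  exists f : nat -> X, [/\ f 0 = x0, forall n, P (f n) & forall n, R (f n) (f n.+1)].
Proof.
move=> Px0 PR.
have /choice[g gP] : forall x, exists y, P x -> P y /\ R x y.
  by move=> x; have [/PR[y Py Rxy]|nPx] := pselect (P x); [exists y | exists x].
have Pf n : P (iter n g x0) by elim: n => //= n /gP[].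
by exists (fun n => iter n g x0); split=> // n; have /gP[] := Pf n.
Qed.

Definition subt T (C : set T) x (Cx : C x) : C := SigSub (mem_set Cx).

Lemma valC T (C : set T) (x : C) : C (val x).
Proof. exact: set_mem (valP x). Qed.

Lemma val_setI T (C : set T) (x y : C) : val x = val y -> x = y.
Proof. by case: x y => x Cx [y Cy] /= xy; apply/eq_exist. Qed.

(** * Orders *)

Definition no_descent T (r : rel T) : Prop :=
  forall f : nat -> T, exists n, ~ (r (f n.+1) (f n) /\ f n.+1 <> f n).

Definition wqo T (r : rel T) : Prop :=
  forall f : nat -> T, exists i j, i < j /\ r (f i) (f j).

Section Orders.
Variables (T : Type) (r : rel T).

Lemma por_refl : partial_order r -> reflexive r. Proof. by case=> [[]]. Qed.
Lemma por_trans : partial_order r -> transitive r. Proof. by case=> [[]]. Qed.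
Lemma por_anti : partial_order r -> antisymmetric r. Proof. by case. Qed.

Lemma partial_order_restr (C : set T) : partial_order r -> partial_order (restr r C).
Proof.
move=> [[rr rt] ra]; split; first by split=> [x|y x z]; [apply: rr | apply: rt].
by move=> x y /ra /val_setI.
Qed.

Lemma partial_order_reversal : partial_order r -> partial_order (reversal r).
Proof.
move=> [[rr rt] ra]; split; first by split=> // y x z yx zy; apply: rt zy yx.
by move=> x y /andP[yx xy]; apply: ra; apply/andP.
Qed.

(** Totality and antisymmetry come from the unique minimum of a pair, transitivity from the minimum
    of a triple. *)
Lemma well_order_total_order : well_order r -> total_order r.
Proof.
move=> wo.
have tot x y : r x y || r y x.
  have [|z [[/asboolP Az zmin] _]] := wo (fun z => `[< z = x \/ z = y >]).
    by exists x; apply/asboolP; left.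
  have /zmin zx : x \in (fun z => `[< z = x \/ z = y >]) by apply/asboolP; left.
  have /zmin zy : y \in (fun z => `[< z = x \/ z = y >]) by apply/asboolP; right.
  by case: Az => <-; rewrite (zx, zy) ?orbT.
have refl x : r x x by have /orP[] := tot x x.
have anti : antisymmetric r.
  move=> x y /andP[xy yx].
  have [|z [_ zu]] := wo (fun z => `[< z = x \/ z = y >]).
    by exists x; apply/asboolP; left.
  rewrite -(zu x) ?(zu y) //; split; try by apply/asboolP; auto.
    by move=> _ /asboolP[]->.
  by move=> _ /asboolP[]->.
split; last exact: tot; split; last exact: anti; split=> // y x z xy yz.
have [|m [[/asboolP Am mmin] _]] :=
  wo (fun u => `[< u = x \/ u = y \/ u = z >]).
  by exists x; apply/asboolP; left.
have mx : r m x by apply: mmin; apply/asboolP; auto.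
have my : r m y by apply: mmin; apply/asboolP; auto.
have mz : r m z by apply: mmin; apply/asboolP; auto.
case: Am => [<-//|[e|e]]; subst m.
  by rewrite (anti x y) // xy.
by rewrite -(anti y z) // yz.
Qed.

Lemma well_order_no_descent : well_order r -> no_descent r.
Proof.
move=> wo f; apply: contrapT => /forallNP nd.
have {}nd n : r (f n.+1) (f n) /\ f n.+1 <> f n by exact: contrapT (nd n).
have [|z [[/asboolP[n _ <-] zmin] _]] := wo (fun z => `[< range f z >]).
  by exists (f 0); apply/asboolP; exists 0.
have [fSn] := nd n; apply; have [[_ anti] _] := well_order_total_order wo.
by apply: anti; rewrite fSn zmin //; apply/asboolP; exists n.+1.
Qed.

Lemma no_descent_min (A : set T) : partial_order r -> no_descent r -> A !=set0 ->
  exists2 m, A m & forall y, A y -> r y m -> y = m.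
Proof.
move=> por nd [x0 Ax0]; apply: contrapT => nomin.
have [x Ax|f [_ _ fP]] := @dependent_choice_in T A (fun x y => r y x /\ y <> x) x0 Ax0.
  apply: contrapT => nx; apply: nomin; exists x => // y Ay yx.
  by apply: contrapT => yNx; apply: nx; exists y.
by have [n] := nd f; apply; apply: fP.
Qed.

Lemma no_descent_well_order : total_order r -> no_descent r -> well_order r.
Proof.
move=> [por tot] nd; apply: antisymmetric_well_order; first exact: por_anti por.
move=> A [x Ax].
have [|m Am mmin] := @no_descent_min [set x | x \in A] por nd; first by exists x.
exists m; split=> // y Ay; have /orP[//|ym] := tot m y.
by rewrite (mmin y Ay ym) por_refl.
Qed.

Lemma wqo_no_descent : partial_order r -> wqo r -> no_descent r.
Proof.
move=> por w f; apply: contrapT => /forallNP nd.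
have {}nd n : r (f n.+1) (f n) /\ f n.+1 <> f n by exact: contrapT (nd n).
have desc i k : r (f (i + k)) (f i).
  elim: k => [|k IH]; first by rewrite addn0 por_refl.
  by rewrite addnS (por_trans por _ IH) //; case: (nd (i + k)).
have [i [j [ij rij]]] := w f; have [rSi] := nd i; apply.
apply: (por_anti por); rewrite rSi (por_trans por rij) //.
by rewrite -(subnKC ij) desc.
Qed.

End Orders.

Lemma infinite_injection T (C : set T) : infinite_set C ->
  exists2 f : nat -> T, injective f & forall n, C (f n).
Proof.
move=> /infiniteP/card_leP[f].
exists (fun n => val (f (subt (C := [set: nat]) (x := n) I))); last by move=> n; apply: valC.
move=> i j /val_setI e.
have /(congr1 val) := @inj _ _ _ f _ _ (mem_set I) (mem_set I) e.
by [].
Qed.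

Lemma wqo_FAC T (r : rel T) : wqo r -> FAC r.
Proof.
move=> w C Canti; apply: contrapT => /infinite_injection[f finj Cf].
have [i [j [ij rij]]] := w f.
by have /finj e := Canti _ _ (Cf i) (Cf j) rij; rewrite e ltnn in ij.
Qed.

(** * Thin families and barriers *)

Definition seq_in (M : set nat) (s : seq nat) : Prop := forall n, n \in s -> M n.

Lemma seq_in_cons M m s : seq_in M (m :: s) -> M m /\ seq_in M s.
Proof.
by move=> sM; split=> [|n ns]; apply: sM; rewrite inE ?eqxx ?ns ?orbT.
Qed.

(** Extends the filter of the sets that contain all but finitely many points of [N]. *)
Lemma ultrafilter_on (N : set nat) : infinite_set N ->
  exists U : set_system nat,
    [/\ UltraFilter U, U N & forall n, U [set k | n < k]].
Proof.
move=> Ninf; pose F : set_system nat := [set D | finite_set (N `\` D)].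
have FF : ProperFilter F.
  apply: Build_ProperFilter_ex.
    move=> D FD; apply: contrapT => nD; apply: Ninf.
    by apply: sub_finite_set FD => n Nn; split=> // Dn; apply: nD; exists n.
  split.
  - by rewrite /F /= setDT.
  - by move=> P Q FP FQ; rewrite /F /= setDIr finite_setU.
  - by move=> P Q PQ; apply: sub_finite_set; apply: setDS.
have [U [UU FU]] := ultraFilterLemma FF; exists U; split=> //.
- by apply: FU; rewrite /F /= setDv.
- move=> n; apply: FU; rewrite /F /=.
  apply: (@sub_finite_set _ _ `I_n.+1); last exact: finite_II.
  by move=> k [_ /= /negP]; rewrite -leqNgt.
Qed.

Lemma sorted_ltn_subseq (s t : seq nat) :
  sorted ltn s -> sorted ltn t -> {subset s <= t} -> subseq s t.
Proof.
move=> ss st sub; suff -> : s = seq.filter [in s] t by exact: filter_subseq.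
apply: (irr_sorted_eq ltn_trans ltnn) => //; first exact: sorted_filter ltn_trans _ _ st.
by move=> n; rewrite mem_filter andbC; case: (boolP (n \in s)) => [/sub->|]; rewrite ?andbF.
Qed.

Lemma leq_foldr_maxn (s : seq nat) n : n \in s -> n <= foldr maxn 0 s.
Proof.
elim: s => //= a s IH.
by rewrite inE => /orP[/eqP->|/IH ns]; rewrite leq_max ?leqnn ?ns ?orbT.
Qed.

Lemma sorted_rcons_ltn (l : seq nat) n :
  sorted ltn l -> (forall k, k \in l -> k < n) -> sorted ltn (rcons l n).
Proof.
case: l => //= a l la ln; rewrite rcons_path la; apply: ln; exact: mem_last.
Qed.

(** A list has finitely many subsequences, so this is a finite intersection; the induction separates
    the subsequences that use the head from the others. *)
Lemma filter_subseqs (U : set_system nat) (Q : seq nat -> set nat) l : Filter U ->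
  (forall s, subseq s l -> U (Q s)) ->
  U [set n | forall s, subseq s l -> Q s n].
Proof.
move=> UF; elim: l Q => [|a l IH] Q UQ.
  by apply: filterS (UQ [::] isT) => n Qn s; rewrite subseq0 => /eqP->.
have U1 : U [set n | forall s, subseq s l -> Q s n].
  by apply: IH => s sl; apply: UQ; apply: (subseq_trans sl (subseq_cons l a)).
have U2 : U [set n | forall s, subseq s l -> Q (a :: s) n].
  by apply: (IH (Q \o cons a)) => s sl; apply: UQ; rewrite /= eqxx.
apply: filterS (filterI U1 U2) => n [H1 H2] [|b s] /=.
  by move=> _; apply: H1; apply: sub0seq.
by case: eqP => [-> /H2|_ /H1].
Qed.

Lemma subseq_rconsP (s l : seq nat) n : subseq s (rcons l n) ->
  subseq s l \/ exists2 s', s = rcons s' n & subseq s' l.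
Proof.
rewrite -subseq_rev rev_rcons; case: (lastP s) => [|{}s k]; first by left; apply: sub0seq.
rewrite rev_rcons /=; case: eqP => [->|_]; rewrite -?rev_rcons subseq_rev; last by left.
by right; exists s.
Qed.

(** Fusion: [M] is enumerated increasingly, and each new element is chosen so that [P] still holds
    on all subsequences of the list so far. Only finitely many [U]-large sets have to be met at each
    step. *)
Lemma thinning (N : set nat) (U : set_system nat) (P : seq nat -> Prop) :
    UltraFilter U -> U N -> (forall n, U [set k | n < k]) -> P [::] ->
    (forall s, P s -> U [set n | P (rcons s n)]) ->
  exists M : set nat, [/\ infinite_set M, M `<=` N &
    forall s, sorted ltn s -> seq_in M s -> P s].
Proof.
move=> UU UN Uinf P0 PS.
pose good l := [/\ sorted ltn l, seq_in N l & forall s, subseq s l -> P s].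
have [||f [f0 fP fS]] :=
  @dependent_choice_in _ good (fun l l' => exists n, l' = rcons l n) [::].
- by split=> // s; rewrite subseq0 => /eqP->.
- move=> l [sl lN lP].
  have Ul : U [set k | forall s, subseq s l -> P (rcons s k)].
    by apply: filter_subseqs => s /lP/PS.
  have [k [[Nk /= lk] Pk]] := filter_ex (filterI (filterI UN (Uinf (foldr maxn 0 l))) Ul).
  have {}lk n : n \in l -> n < k.
    by move=> nl; apply: leq_ltn_trans lk; exact: leq_foldr_maxn.
  exists (rcons l k); last by exists k.
  split; first exact: sorted_rcons_ltn.
    by move=> n; rewrite mem_rcons inE => /orP[/eqP->|/lN].
  by move=> s /subseq_rconsP[/lP|[s' -> /Pk]].
have fsize n : size (f n) = n.
  by elim: n => [|n IH]; rewrite ?f0 //; have [k ->] := fS n; rewrite size_rcons IH.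
have fmono m n : m <= n -> subseq (f m) (f n).
  elim: n => [|n IH]; first by rewrite leqn0 => /eqP->.
  rewrite leq_eqVlt => /orP[/eqP->//|]; rewrite ltnS => /IH mn.
  by have [k ->] := fS n; apply: subseq_trans mn (subseq_rcons _ _).
exists [set k | exists n, k \in f n]; split.
- move=> /finite_seqP[t tE].
  have [sn _ _] := fP (size t).+1.
  have := uniq_leq_size (sorted_uniq ltn_trans ltnn sn) (s2 := t).
  rewrite fsize ltnn => sub; apply: notF; apply: sub => k kn.
  by have : [set` t] k by rewrite -tE; exists (size t).+1.
- by move=> k [n kn]; have [_ + _] := fP n; apply.
move=> s ss sM; have [n sn] : exists n, {subset s <= f n}.
  elim: s sM {ss} => [|a s IH]; first by exists 0.
  move=> /seq_in_cons[[m am] /IH[n sn]]; exists (maxn m n) => k; rewrite inE => /orP[/eqP->|].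
    exact: (mem_subseq (fmono _ _ (leq_maxl m n))).
  by move/sn; exact: (mem_subseq (fmono _ _ (leq_maxr m n))).
have [sn' _] := fP n; apply; exact: sorted_ltn_subseq.
Qed.

(** Membership in [E] propagated backwards along [U]-almost all one-point extensions. For an
    ultrafilter, inaccessibility is inherited by [U]-almost all one-point extensions, so both
    alternatives can be fed to [thinning]. *)
Inductive accessible (U : set_system nat) (E : set (seq nat)) : seq nat -> Prop :=
| accessible_in s : E s -> accessible U E s
| accessible_step s D : U D -> (forall n, D n -> accessible U E (rcons s n)) ->
    accessible U E s.

Lemma accessible_extends U E s : ProperFilter U -> accessible U E s ->
  exists2 e, E e & prefix s e.
Proof.
move=> UU; elim=> {s} [s Es|s D UD _ IH]; first by exists s; rewrite ?prefix_refl.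
have [n /IH[e Ee se]] := filter_ex UD.
by exists e => //; apply: prefix_trans se; apply: prefix_rcons.
Qed.

(* Nash-Williams' theorem for a prefix-free family F.  The ultrafilter turns the
   usual fusion argument into the choice of a single set. *)
Lemma nash_williams (F E : set (seq nat)) (N : set nat) :
    (forall s t, F s -> F t -> prefix s t -> s = t) -> infinite_set N ->
  exists M : set nat, [/\ infinite_set M, M `<=` N &
    (forall s, F s -> sorted ltn s -> seq_in M s -> E s) \/
    (forall s, F s -> sorted ltn s -> seq_in M s -> ~ E s)].
Proof.
move=> Ffree /ultrafilter_on[U [UU UN Uinf]].
pose acc := accessible U (F `&` E).
have [acc0|nacc0] := pselect (acc [::]).
  (* The property preserved along [M]: either an initial segment already lies in [F] and [E], or the
     sequence is still accessible. On a member of [F], prefix-freeness turns both into membership in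
     [E]. *)
  have [|s|M [Minf MN MP]] :=
    @thinning N U (fun s => (exists k, (F `&` E) (take k s)) \/ acc s) UU UN Uinf.
  - by right.
  - have step k : (F `&` E) (take k s) ->
        U [set n | (exists k, (F `&` E) (take k (rcons s n))) \/ acc (rcons s n)].
      move=> Ek; apply: filterS filterT => n _; left.
      have [ks|sk] := leqP k (size s).
        by exists k; rewrite -cats1 takel_cat.
      exists (size s); rewrite -cats1 take_size_cat //.
      by rewrite take_oversize // ltnW in Ek.
    move=> [[k /step//]|]; case=> {s step} [s Es|s D UD DP]; last first.
      by apply: filterS UD => n /DP; right.
    by apply: filterS filterT => n _; left; exists (size s); rewrite -cats1 take_size_cat.
  exists M; split=> //; left=> s Fs ss sM.
  have [[k [Fk Ek]]|as_] := MP s ss sM.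
    by rewrite -(Ffree _ _ Fk Fs (prefix_take _ _)).
  have [e [Fe Ee] se] := accessible_extends _ as_.
  by rewrite (Ffree _ _ Fs Fe se).
have [||M [Minf MN MP]] := @thinning N U (fun s => ~ acc s) UU UN Uinf => //.
  move=> s nas; have [Us|//] := in_ultra_setVsetC [set n | acc (rcons s n)] UU.
  by case: nas; apply: (accessible_step Us).
exists M; split=> //; right=> s Fs ss sM Es; apply: (MP s ss sM).
exact: accessible_in.
Qed.

Lemma initial_segmentE s X : sorted ltn s -> initial_segment s X ->
  exists k, s = [seq n <- iota 0 k | `[< X n >]].
Proof.
(* The cut-off is one more than the largest element of [s], and 0 when [s] is empty. *)
move=> ss [sX Xs]; exists (foldr maxn 0 (map S s)).
have smax n : n \in s -> n < foldr maxn 0 (map S s).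
  by move=> ns; apply: leq_foldr_maxn; exact: map_f.
have maxs n : n < foldr maxn 0 (map S s) -> exists2 m, m \in s & n <= m.
  elim: (s) => //= a l IH; rewrite leq_max => /orP[na|/IH[m ml nm]].
    by exists a; rewrite ?inE ?eqxx.
  by exists m; rewrite // inE ml orbT.
apply: (irr_sorted_eq ltn_trans ltnn) => //.
  exact: sorted_filter ltn_trans _ _ (iota_ltn_sorted _ _).
move=> n; rewrite mem_filter mem_iota /= add0n; apply/idP/idP.
  by move=> ns; rewrite smax // andbT; apply/asboolP/sX.
by move=> /andP[/asboolP Xn /maxs[m ms nm]]; apply: Xs Xn ms nm.
Qed.

Lemma prefix_mem (s t : seq nat) : prefix s t -> {subset s <= t}.
Proof. by move=> /prefixW/infixW/mem_subseq. Qed.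

Lemma prefix_total (s1 s2 t : seq nat) :
  prefix s1 t -> prefix s2 t -> prefix s1 s2 \/ prefix s2 s1.
Proof.
move=> /prefixP[u ->]; rewrite [prefix s2 _]prefixE => /eqP e2.
have [le12|/ltnW le21] := leqP (size s2) (size s1).
  by right; rewrite -e2 takel_cat // prefix_take.
by left; rewrite -e2 take_cat ltnNge le21 /= prefix_prefix.
Qed.

Lemma initial_segment_prefix s t X : sorted ltn s -> sorted ltn t ->
  initial_segment s X -> initial_segment t X -> prefix s t \/ prefix t s.
Proof.
move=> ss st /(initial_segmentE ss)[k ->] /(initial_segmentE st)[l ->].
have pre i j : i <= j ->
    prefix [seq n <- iota 0 i | `[< X n >]] [seq n <- iota 0 j | `[< X n >]].
  by move=> /subnKC<-; rewrite iotaD filter_cat prefix_prefix.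
by case/orP: (leq_total k l) => /pre; [left | right].
Qed.

Lemma infinite_unbounded (X : set nat) k : infinite_set X -> exists2 n, X n & k < n.
Proof.
move=> Xinf; apply: contrapT => nX; apply: Xinf.
apply: (@sub_finite_set _ _ `I_k.+1); last exact: finite_II.
by move=> n Xn /=; rewrite ltnS leqNgt; apply/negP => kn; apply: nX; exists n.
Qed.

Lemma infinite_above (X : set nat) k : infinite_set X ->
  infinite_set (X `&` [set n | k < n]).
Proof.
move=> Xinf; have -> : X `&` [set n | k < n] = X `\` `I_k.+1.
  by apply/seteqP; split=> n /= [Xn]; rewrite ltnS; [move=> kn|move=> /negP kn];
    split=> //; rewrite ?ltnNge //; apply/negP; rewrite -ltnNge.
exact: infinite_setD.
Qed.

(** * Fronts of infinite sets and a Ramsey theorem for barriers *)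

Section Barrier.
Variables (B : set (seq nat)) (Bbar : barrier B).

Definition base : set nat := [set n | exists2 s, B s & n \in s].

Lemma barrier_prefix s t : B s -> B t -> prefix s t -> s = t.
Proof.
move=> Bs Bt st; apply: (barrier_antichain Bbar) => //.
exact: prefix_mem.
Qed.

Lemma barrier_nil : ~ B [::].
Proof.
move=> B0; apply: (barrier_infinite Bbar).
apply: (@sub_finite_set _ _ [set [::]]); last exact: finite_set1.
by move=> s Bs /=; rewrite -(barrier_prefix B0 Bs) ?prefix0s.
Qed.

(** On infinite subsets of [base] the barrier property provides a value, and [front_unique] makes it
    the only one. The default [[::]] is never a member of a barrier. *)
Definition front (X : set nat) : seq nat :=
  xget [::] [set s | B s /\ initial_segment s X].

Lemma frontP X : infinite_set X -> X `<=` base ->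
  B (front X) /\ initial_segment (front X) X.
Proof.
move=> Xinf /(barrier_bar Bbar Xinf)[s Bs sX].
exact: (xgetPex [::] (ex_intro [set s | B s /\ initial_segment s X] s (conj Bs sX))).
Qed.

Lemma front_unique s X : B s -> initial_segment s X -> front X = s.
Proof.
move=> Bs sX; have [Bf fX] : B (front X) /\ initial_segment (front X) X.
  exact: (xgetPex [::] (ex_intro [set s | B s /\ initial_segment s X] s (conj Bs sX))).
have sf := barrier_sorted Bbar Bf; have ss := barrier_sorted Bbar Bs.
have [p|p] := initial_segment_prefix sf ss fX sX; first exact: barrier_prefix p.
by apply/esym; exact: barrier_prefix p.
Qed.

(** The tail of the first front and the second front are both initial segments of [Y], hence
    comparable by prefix. The second is not a prefix of the tail, as it would then be properly
    contained in the first front. *)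
Lemma front_cons m Y : infinite_set Y -> Y `<=` base -> base m ->
  (forall y, Y y -> m < y) -> triangle (front (m |` Y)) (front Y).
Proof.
move=> Yinf Yb bm mY.
have [Bs [sX Xs]] : B (front (m |` Y)) /\ initial_segment (front (m |` Y)) (m |` Y).
  apply: frontP; last by move=> n [->|/Yb].
  by apply: sub_infinite_set Yinf => y Yy; right.
have [Bt tY] := frontP Yinf Yb.
move: (front (m |` Y)) (front Y) Bs sX Xs Bt tY => [|a s] t Bs sX Xs Bt tY.
  by case: barrier_nil.
have ss := barrier_sorted Bbar Bs; have st := barrier_sorted Bbar Bt.
have am : a = m.
  have XYa : (m |` Y) a by apply: sX; rewrite mem_head.
  have ms : m \in a :: s.
    case: XYa => [<-|/mY ma]; first exact: mem_head.
    by apply: (Xs m a); [left | rewrite mem_head | apply: ltnW].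
  move: ms; rewrite inE => /orP[/eqP//|ms].
  have /allP/(_ _ ms) am := order_path_min ltn_trans ss.
  by case: XYa => // /mY; rewrite ltnNge ltnW.
subst a; have sY : initial_segment s Y.
  split=> [n ns|n k Yn ks nk].
    have /allP/(_ _ ns) mn := order_path_min ltn_trans ss.
    have [e|//] : (m |` Y) n by apply: sX; rewrite inE ns orbT.
    by rewrite e ltnn in mn.
  have : n \in m :: s by apply: (Xs n k) => //; [right | rewrite inE ks orbT].
  by rewrite inE => /orP[/eqP e|//]; have := mY _ Yn; rewrite e ltnn.
have tNs : ~ prefix t s.
  move=> ts; have e : t = m :: s.
    apply: (barrier_antichain Bbar) => // n nt.
    by rewrite inE (prefix_mem ts nt) orbT.
  by have := size_prefix ts; rewrite e /= ltnn.
have st' : prefix s t.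
  by case: (initial_segment_prefix (path_sorted ss) st sY tY).
case: t Bt tY st tNs st' => [|b t] Bt tY st tNs st'; first by case: barrier_nil.
rewrite /triangle st' mY /=; last by apply: tY.1; rewrite mem_head.
by apply/eqP => e; apply: tNs; rewrite e prefix_refl.
Qed.

(** Removing the elements of [u] one at a time from the left moves the front by one triangle step
    each, and each step applies [phi]. Fronts of far tails of [M] can thus be compared with any
    given member of [B]. *)
Lemma front_shift V (g : seq nat -> V) (phi : V -> V) (M Y : set nat) u :
    M `<=` base -> infinite_set Y -> Y `<=` M ->
    (forall s t, B s -> B t -> seq_in M s -> seq_in M t -> triangle s t -> g t = phi (g s)) ->
    sorted ltn u -> seq_in M u -> (forall x y, x \in u -> Y y -> x < y) ->
  g (front Y) = iter (size u) phi (g (front ([set` u] `|` Y))).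
Proof.
move=> Mb Yinf YM gphi; elim: u => [|m u IH] su uM uY.
  by rewrite set_nil set0U.
have [Mm {}uM] := seq_in_cons uM.
pose X := [set` u] `|` Y.
have Xinf : infinite_set X by apply: sub_infinite_set Yinf => y; right.
have XM : X `<=` M by move=> n [/uM|/YM].
have mX x : X x -> m < x.
  case=> [xu|Yx]; last by apply: uY; rewrite ?mem_head.
  by have /allP := order_path_min ltn_trans su; apply.
have -> : [set` m :: u] `|` Y = m |` X.
  rewrite setUA; congr (_ `|` _); apply/seteqP; split=> n /=.
    by rewrite inE => /orP[/eqP->|nu]; [left|right].
  by case=> [->|nu]; rewrite /= inE ?eqxx ?nu ?orbT.
have XmM : m |` X `<=` M by move=> n [->|/XM].
have Xb := subset_trans XM Mb; have XmMb := subset_trans XmM Mb.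
have Xminf : infinite_set (m |` X) by apply: sub_infinite_set Xinf => y; right.
have [Bf [fX _]] := frontP Xinf Xb; have [Bfm [fmX _]] := frontP Xminf XmMb.
rewrite iterSr -(gphi _ (front X)) //; first 1 last.
- by move=> n /fmX/XmM.
- by move=> n /fX/XM.
- by apply: front_cons => //; apply: Mb.
apply: IH => //; first exact: path_sorted su.
by move=> x y xu Yy; apply: uY; rewrite // inE xu orbT.
Qed.

Lemma front_cat s Y : B s -> (forall x y, x \in s -> Y y -> x < y) ->
  front ([set` s] `|` Y) = s.
Proof.
move=> Bs sY; apply: front_unique => //; split=> [n ns|n m [//|Yn] ms nm]; first by left.
by have := sY _ _ ms Yn; rewrite ltnNge nm.
Qed.

(** Infinity is the point to check: if there were finitely many members, the front of the part of
    [M] above all their elements would be a further one. *)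
Lemma barrier_restrict M : infinite_set M -> M `<=` base ->
  barrier (B `&` [set s | seq_in M s]).
Proof.
move=> Minf Mb.
have bar X : infinite_set X -> X `<=` M ->
    exists2 s, (B `&` [set s | seq_in M s]) s & initial_segment s X.
  move=> Xinf XM; have [Bf [fX Xf]] := frontP Xinf (subset_trans XM Mb).
  by exists (front X) => //; split=> // n /fX/XM.
split.
- by move=> s [/(barrier_sorted Bbar)].
- move=> /(finite_image (fun s => foldr maxn 0 s))/finite_seqP[l lE].
  have [s [Bs sM] [sX _]] := bar _ (@infinite_above M (foldr maxn 0 l) Minf) (@subIsetl _ _ _).
  case: s Bs sM sX => [/barrier_nil//|a s] Bs sM sX.
  have [_ /= la] := sX a (mem_head _ _).
  have : foldr maxn 0 (a :: s) \in l.
    suff : [set` l] (foldr maxn 0 (a :: s)) by [].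
    by rewrite -lE; exists (a :: s).
  move=> /leq_foldr_maxn; rewrite leqNgt; apply/negP/negPn; apply: leq_trans la _.
  exact/leq_foldr_maxn/mem_head.
- by move=> s t [Bs _] [Bt _]; apply: (barrier_antichain Bbar).
- move=> X Xinf Xb; apply: bar => // n /Xb[s [_ sM] /sM//].
Qed.

(** A triangle pair [s], [t] is coded by the single sequence [m :: t] with [m] the minimum of [s]:
    the rest of [s] is a prefix of [t], and the antichain condition allows only one such prefix. The
    codes form a prefix-free family, to which [nash_williams] applies. *)
Lemma barrier_ramsey (P : seq nat -> seq nat -> Prop) :
  exists M : set nat, [/\ infinite_set M, M `<=` base &
    (forall s t, B s -> B t -> seq_in M s -> seq_in M t -> triangle s t -> P s t) \/
    (forall s t, B s -> B t -> seq_in M s -> seq_in M t -> triangle s t -> ~ P s t)].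
Proof.
(* With a finite base, all members of [B] would be subsequences of one list. *)
have binf : infinite_set base.
  move=> bfin; apply: (barrier_infinite Bbar).
  have /finite_seqP[l lE] := bfin.
  pose L := sort leq (undup l).
  have sL : sorted ltn L.
    by rewrite ltn_sorted_uniq_leq sort_uniq undup_uniq sort_sorted //; exact: leq_total.
  suff : finite_set [set mask (val m) L | m in [set: (size L).-tuple bool]].
    apply: sub_finite_set => s Bs /=.
    have /subseqP[m /eqP sm ->] : subseq s L.
      apply: sorted_ltn_subseq => //; first exact: barrier_sorted Bs.
      move=> n ns; rewrite mem_sort mem_undup.
      suff : [set` l] n by [].
      by rewrite -lE; exists s.
    by exists (Tuple sm).
  apply: finite_image; exact: finite_finset.
pose F := [set u | if u is m :: t then B t /\ m < head 0 t else False].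
pose E := [set u | if u is m :: t then
  exists s, [/\ B (m :: s), prefix s t & P (m :: s) t] else False].
have [|M [Minf Mb MP]] := @nash_williams F E base _ binf.
  move=> [|m s]// [|n t]// [Bs _] [Bt _] /=.
  by case: eqP => //= <- /(barrier_prefix Bs Bt)->.
have inF s t : B s -> B t -> seq_in M s -> seq_in M t -> triangle s t ->
    exists m s', [/\ s = m :: s', F (m :: t), sorted ltn (m :: t), seq_in M (m :: t) & prefix s' t].
  case: s t => [|m s] [|n t] //= Bs Bt sM tM /and3P[mn pst _]; exists m, s; split=> //.
  - by have := barrier_sorted Bbar Bt; rewrite /= mn.
  - by move=> k; rewrite inE => /orP[/eqP->|/tM//]; apply: sM; rewrite mem_head.
exists M; split=> //; case: MP => MP; [left|right] => s t Bs Bt sM tM st.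
  have [m [s' [es Fm sm mM pst]]] := inF s t Bs Bt sM tM st.
  have [s2 [Bs2 ps2 Ps2]] := MP _ Fm sm mM; rewrite es.
  have Bs' : B (m :: s') by rewrite -es.
  suff -> : m :: s' = m :: s2 by [].
  have [p|p] := prefix_total pst ps2.
    by apply: (barrier_prefix Bs' Bs2); rewrite prefix_cons eqxx.
  by apply/esym; apply: (barrier_prefix Bs2 Bs'); rewrite prefix_cons eqxx.
have [m [s' [es Fm sm mM pst]]] := inF s t Bs Bt sM tM st.
by move=> Pst; apply: (MP _ Fm sm mM); exists s'; rewrite -es.
Qed.

End Barrier.

(** * Ordinal types *)

Lemma total_order_restr T (r : rel T) (C : set T) :
  total_order r -> total_order (restr r C).
Proof.
by move=> [por tot]; split; [apply: partial_order_restr | move=> x y; apply: tot].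
Qed.

Lemma well_order_wf T (r : rel T) : well_order r ->
  well_founded (fun x y => r x y /\ x <> y).
Proof.
move=> wo x; apply: contrapT => nx.
have [|m [[/asboolP nm mmin] _]] :=
  wo (fun x => `[< ~ Acc (fun x y => r x y /\ x <> y) x >]).
  by exists x; apply/asboolP.
apply: nm; split=> y [ym yNm]; apply: contrapT => ny; apply: yNm.
have [[_ anti] _] := well_order_total_order wo.
by apply: anti; rewrite ym mmin //; apply/asboolP.
Qed.

(** By well-founded recursion every [t] receives the least value not taken by its predecessors, so
    the values form an initial segment. The last hypothesis guarantees that a free value always
    remains. *)
Lemma collapse T (r : rel T) A (al : rel A) (a0 : A) : well_order r -> well_order al ->
    (forall t (c : T -> A),
      (forall u, r u t /\ u <> t -> forall a, al a (c u) -> a <> c u ->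
         exists2 v, r v u /\ v <> u & c v = a) ->
      exists a, forall u, r u t /\ u <> t -> c u <> a) ->
  otype_le r al.
Proof.
move=> wor woal big.
have [[[rr rt] ra] tot] := well_order_total_order wor.
have [[[alr alt] ala] total] := well_order_total_order woal.
pose ismin (S : A -> Prop) a := S a /\ forall b, S b -> al a b.
have /choice[mu muP] : forall S : A -> Prop, exists a, (exists b, S b) -> ismin S a.
  move=> S; have [[b Sb]|nS] := pselect (exists b, S b); last by exists a0.
  have [|m [[/asboolP mP mmin] _]] := woal (fun a => `[< S a >]).
    by exists b; apply/asboolP.
  by exists m => _; split=> // a Sa; apply: mmin; apply/asboolP.
pose F t (c : forall u, r u t /\ u <> t -> A) : A :=
  mu (fun a => forall u (ut : r u t /\ u <> t), c u ut <> a).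
pose c := Fix (well_order_wf wor) (fun=> A) F.
have cE t : c t = mu (fun a => forall u, r u t /\ u <> t -> c u <> a).
  rewrite /c Fix_eq // => x f g fg; congr F.
  by apply: functional_extensionality_dep => u; apply: functional_extensionality_dep => p.
have cP t : ismin (fun a => forall u, r u t /\ u <> t -> c u <> a) (c t).
  elim/(well_founded_ind (well_order_wf wor)): t => t IH; rewrite (cE t).
  apply: muP; apply: (big t c) => u ut a au aNu.
  have [_ umin] := IH u ut; apply: contrapT => nv; apply: aNu; apply: ala; rewrite au.
  by apply: umin => v vu cv; apply: nv; exists v.
have cmono u t : r u t /\ u <> t -> al (c u) (c t) /\ c u <> c t.
  move=> [ut uNt]; split; last by apply: (cP t).1.
  apply: (cP u).2 => v [vu vNu]; apply: (cP t).1; split; first exact: rt vu ut.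
  by move=> vt; subst v; apply: uNt; apply: ra; rewrite ut vu.
exists c.
  move=> x y; have [->|xNy] := pselect (x = y); first by rewrite rr alr.
  case/orP: (tot x y) => [xy|yx].
    by have [axy _] := cmono x y (conj xy xNy); rewrite xy axy.
  have [ayx yNx] := cmono y x (conj yx (nesym xNy)).
  apply/idP/idP => [axy|xy]; first by case: yNx; apply: ala; rewrite ayx axy.
  by case: xNy; apply: ra; rewrite xy yx.
move=> x a ax; apply: contrapT => na.
have aNx : a <> c x by move=> e; apply: na; exists x.
apply: aNx; apply: ala; rewrite ax; apply: (cP x).2 => u _ cu; apply: na; by exists u.
Qed.

Lemma mono_total_well_order T (r : rel T) A (al : rel A) (g : T -> A) :
  total_order r -> well_order al -> {mono g : x y / r x y >-> al x y} -> well_order r.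
Proof.
move=> rtot woal gm; apply: no_descent_well_order => // f.
have [n nP] := well_order_no_descent woal (g \o f); exists n => -[fS fN]; apply: nP.
split; first by rewrite /= gm.
have [[[alr _] _] _] := well_order_total_order woal.
move=> /= e; apply: fN; case: rtot => [[_ ra] _]; apply: ra.
by rewrite fS /= -gm -e alr.
Qed.

(** The range of [g] need not be an initial segment, so [g] is collapsed. The collapse stays below
    [g], hence [g t] is still free when [t] is reached. *)
Lemma otype_le_mono T (r : rel T) A (al : rel A) (g : T -> A) :
  total_order r -> well_order al -> {mono g : x y / r x y >-> al x y} -> otype_le r al.
Proof.
move=> rtot woal gm; have [[t0]|nT] := pselect (inhabited T); last first.
  by exists g => // x; case: nT.
have wor := mono_total_well_order rtot woal gm.
have [[[alr alt] ala] total] := well_order_total_order woal.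
apply: (@collapse _ _ _ _ (g t0)) => // t c cinit; exists (g t) => u ut cu.
have cg v : r v t /\ v <> t -> al (c v) (g v).
  elim/(well_founded_ind (well_order_wf wor)): v => v IH vt.
  case/orP: (total (c v) (g v)) => // gcv.
  have [->//|gNc] := pselect (g v = c v).
  have [w [wv wNv] cw] := cinit v vt _ gcv gNc.
  have wt : r w t /\ w <> t.
    case: vt => vt vNt; case: rtot => [[[_ rt] ra] _]; split; first exact: rt wv vt.
    by move=> e; subst w; apply: vNt; apply: ra; rewrite vt wv.
  have := IH w (conj wv wNv) wt; rewrite cw gm => vw.
  by case: wNv; case: rtot => [[_ ra] _]; apply: ra; rewrite wv vw.
have [utr uNt] := ut; have := cg u ut; rewrite cu gm => tu.
by apply: uNt; case: rtot => [[_ ra] _]; apply: ra; rewrite utr tu.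
Qed.

Lemma total_order_leq : total_order leq.
Proof.
split; last exact: leq_total.
by split; [split; [exact: leqnn | exact: leq_trans] | exact: anti_leq].
Qed.

Lemma well_order_leq : well_order leq.
Proof.
apply: no_descent_well_order total_order_leq _ => f; apply: contrapT => /forallNP nd.
have desc n : f n + n <= f 0.
  elim: n => [|n IH]; first by rewrite addn0.
  have [fS fN] := contrapT (nd n); rewrite addnS -addSn; apply: leq_trans IH.
  by rewrite leq_add2r ltn_neqAle fS andbT; apply/eqP.
by have := desc (f 0).+1; rewrite addnS ltnNge leq_addl.
Qed.

Lemma otype_le_nat A (al : rel A) :
  well_order al -> infinite_set [set: A] -> otype_le leq al.
Proof.
move=> woal Ainf; have [a0 _] := infinite_setN0 Ainf.
apply: (collapse a0) => // [|n c _]; first exact: well_order_leq.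
apply: contrapT => na; apply: Ainf.
apply: (@sub_finite_set _ _ (c @` `I_n)); last exact/finite_image/finite_II.
move=> a _; apply: contrapT => nca; apply: na; exists a => k [kn kNn] ck.
by apply: nca; exists k => //=; rewrite ltn_neqAle kn andbT; apply/eqP.
Qed.

Lemma lexle_total_order : total_order lexle.
Proof.
split; last by move=> x y; exact: (@Order.TotalTheory.le_total _ (seqlexi nat)).
split; last by move=> x y; exact: (@Order.POrderTheory.le_anti _ (seqlexi nat)).
split; first by move=> x; exact: (@Order.POrderTheory.lexx _ (seqlexi nat)).
by move=> y x z; exact: (@Order.POrderTheory.le_trans _ (seqlexi nat)).
Qed.

(** * Posets with no bad array *)

Section AlphaWqo.
Variables (A : Type) (alpha : rel A) (alpha_ordinal : well_order alpha).

(** With arrays defined on all sequences, passing to a smaller barrier leaves the array and its type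
    unchanged. *)
Lemma alpha_wqoP T (r : rel T) : alpha_wqo alpha r <->
  forall B, barrier B -> otype_le (restr lexle B) alpha -> forall f : seq nat -> T,
  exists s t, [/\ B s, B t, triangle s t & r (f s) (f t)].
Proof.
split=> [w B Bbar Btype f|w B Bbar Btype f].
  have [s [t [st rst]]] := w B Bbar Btype (f \o val).
  by exists (val s), (val t); split=> //; exact: valC.
have [s0 Bs0] : B !=set0 by apply: infinite_setN0; exact: barrier_infinite.
have [s [t [Bs Bt st rst]]] := w B Bbar Btype
  (fun s => if pselect (B s) is left Bs then f (subt Bs) else f (subt Bs0)).
exists (subt Bs), (subt Bt); split=> //; move: rst.
case: pselect => // Bs' ; case: pselect => // Bt'.
by rewrite (val_setI (x := subt Bs) (y := subt Bs')) // (val_setI (x := subt Bt) (y := subt Bt')).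
Qed.

Lemma otype_le_barrier (B C : set (seq nat)) : C `<=` B ->
  otype_le (restr lexle B) alpha -> otype_le (restr lexle C) alpha.
Proof.
move=> CB [g gm _].
apply: (@otype_le_mono _ _ _ _ (fun s : C => g (subt (CB _ (valC s))))) => //.
exact/total_order_restr/lexle_total_order.
Qed.

Lemma alpha_wqo_hom T (r : rel T) T' (r' : rel T') (g : T' -> T) :
  (forall x y, r (g x) (g y) -> r' x y) -> alpha_wqo alpha r -> alpha_wqo alpha r'.
Proof.
move=> gr w B Bbar Btype f; have [s [t [st rst]]] := w B Bbar Btype (g \o f).
by exists s, t; split=> //; exact: gr.
Qed.

(** Sequences are arrays on the barrier of singletons, whose type omega is at most the infinite
    ordinal [alpha]. *)
Lemma alpha_wqo_wqo T (r : rel T) : infinite_set [set: A] -> alpha_wqo alpha r -> wqo r.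
Proof.
move=> Ainf /alpha_wqoP w f; pose B := [set s : seq nat | exists n, s = [:: n]].
have Bbar : barrier B.
  split.
  - by move=> _ [n ->].
  - move=> Bfin; apply: infinite_nat.
    suff -> : [set: nat] = (fun n => [:: n]) @^-1` B.
      by apply: finite_preimage => // x y _ _ [].
    by apply/seteqP; split=> n // _; exists n.
  - move=> _ _ [m ->] [n ->] /(_ m); rewrite !inE eqxx => /(_ isT)/eqP->//.
  - move=> X Xinf _; have [n0 Xn0] := infinite_setN0 Xinf.
    have [|n [[/asboolP Xn nmin] _]] := @well_order_leq (fun n => `[< X n >]).
      by exists n0; apply/asboolP.
    exists [:: n]; first by exists n.
    split=> [m|m k Xm]; rewrite !inE => /eqP-> // mn; rewrite eqn_leq mn.
    by apply: nmin; apply/asboolP.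
have Btype : otype_le (restr lexle B) alpha.
  have [g gm _] := otype_le_nat alpha_ordinal Ainf.
  apply: (@otype_le_mono _ _ _ _ (fun s : B => g (head 0 (val s)))) => //.
    exact/total_order_restr/lexle_total_order.
  move=> x y; rewrite gm; have [[m xm] [n yn]] := (valC x, valC y).
  rewrite /restr /= xm yn -[lexle _ _]/((m <= n) && ((n <= m) ==> true)).
  by rewrite implybT andbT.
have [_ [_ [[m ->] [n ->] mn rmn]]] := w B Bbar Btype (fun s => f (head 0 s)).
by exists m, n; split=> //; case/andP: mn.
Qed.

(** By [barrier_ramsey] one may assume that the class either changes along every triangle pair or
    never does. In the first case a good pair of classes lifts by [hr]; in the second the whole
    array lies in one class. *)
Lemma alpha_wqo_partition T (r : rel T) J (rJ : rel J) (h : T -> J) :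
    alpha_wqo alpha rJ -> (forall j, alpha_wqo alpha (restr r (h @^-1` [set j]))) ->
    (forall x y, rJ (h x) (h y) -> h x <> h y -> r x y) ->
  alpha_wqo alpha r.
Proof.
move=> /alpha_wqoP wJ wh hr; apply/alpha_wqoP => B Bbar Btype f.
have [M [Minf Mb MP]] := barrier_ramsey Bbar (fun s t => h (f s) = h (f t)).
have Cbar := barrier_restrict Bbar Minf Mb; set C := _ `&` _ in Cbar.
have Ctype : otype_le (restr lexle C) alpha by apply: otype_le_barrier Btype => s [].
case: MP => MP; last first.
  have [s [t [[Bs sM] [Bt tM] st rst]]] := wJ C Cbar Ctype (h \o f).
  by exists s, t; split=> //; apply: hr => //; apply: MP.
(* Both values are compared with the class at the front of a tail of [M] beyond [s] and [t], using
   [front_shift] with the identity. *)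
have const s t : C s -> C t -> h (f s) = h (f t).
  move=> [Bs sM] [Bt tM]; pose k := foldr maxn 0 (s ++ t).
  have lek n : n \in s ++ t -> n <= k by exact: leq_foldr_maxn.
  have shift u : B u -> seq_in M u -> {subset u <= s ++ t} ->
      h (f (front B (M `&` [set n | k < n]))) = h (f u).
    move=> Bu uM usub.
    have uY x y : x \in u -> (M `&` [set n | k < n]) y -> x < y.
      by move=> /usub/lek xk [_ /=]; apply: leq_ltn_trans.
    have /= shiftE := @front_shift B Bbar J (h \o f) id M (M `&` [set n | k < n]) u.
    rewrite shiftE //.
    - by rewrite iter_fix // front_cat.
    - exact: infinite_above.
    - by move=> a b Ba Bb aM bM ab; rewrite /= (MP a b).
    - exact: (barrier_sorted Bbar).
  by rewrite -(shift s) ?(shift t) // => n; rewrite mem_cat => ->; rewrite ?orbT.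
have [s0 Cs0] : C !=set0 by apply: infinite_setN0; exact: barrier_infinite.
have fib s : C s -> (h @^-1` [set h (f s0)]) (f s) by move=> Cs; exact: const.
have [s [t [st rst]]] := wh (h (f s0)) C Cbar Ctype (fun s => subt (fib _ (valC s))).
by exists (val s), (val t); split=> //; [case: (valC s) | case: (valC t)].
Qed.

(** Exactly the consecutive numbers are incomparable. This orders the blocks of the counterexample
    below. *)
Definition semi : rel nat := fun i j => (i == j) || (i.+2 <= j).

(** Along a triangle pair a bad array either decreases or increases by exactly one, and
    [barrier_ramsey] makes one case uniform. Decreasing is impossible at a front with least value.
    In the other case all fronts of far tails have the same value, by [front_shift] from one fixed
    [s], although dropping the least element of a tail raises it by one. *)
Lemma alpha_wqo_semi : alpha_wqo alpha semi.
Proof.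
apply/alpha_wqoP => B Bbar Btype f; apply: contrapT => bad.
have {}bad s t : B s -> B t -> triangle s t -> f t < f s \/ f t = (f s).+1.
  move=> Bs Bt st; have : ~ semi (f s) (f t) by move=> sf; apply: bad; exists s, t.
  rewrite /semi; case: (ltngtP (f t) (f s)) => [lt _|lt /=|<- []]; [by left| |by []].
  by move=> /negP; rewrite -ltnNge ltnS => le; right; apply/eqP; rewrite eqn_leq le lt.
have [M [Minf Mb MP]] := barrier_ramsey Bbar (fun s t => f t < f s).
have bM s t : B s -> B t -> seq_in M s -> seq_in M t -> triangle s t ->
    ~ f t < f s -> f t = (f s).+1.
  by move=> Bs Bt _ _ st nts; case: (bad s t).
have frontM X : infinite_set X -> X `<=` M -> B (front B X) /\ seq_in M (front B X).
  move=> Xinf XM; have [Bf [fX _]] := frontP Bbar Xinf (subset_trans XM Mb).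
  by split=> // n /fX/XM.
have above_inf X : infinite_set X -> exists m, exists2 Y,
    X = m |` Y & infinite_set Y /\ (forall y, Y y -> m < y).
  move=> Xinf; have [n0 Xn0] := infinite_setN0 Xinf.
  have [|m [[/asboolP Xm mmin] _]] := @well_order_leq (fun n => `[< X n >]).
    by exists n0; apply/asboolP.
  exists m, (X `&` [set n | m < n]).
    apply/seteqP; split=> [n Xn|n [->//|[]//]].
    have [->|mNn] := eqVneq n m; first by left.
    by right; split=> //=; rewrite ltn_neqAle eq_sym mNn mmin //; apply/asboolP.
  by split; [exact: infinite_above | move=> n []].
case: MP => MP.
  have [|n [[/asboolP[X [Xinf XM <-]] nmin] _]] :=
    @well_order_leq (fun n => `[< exists X, [/\ infinite_set X, X `<=` M & f (front B X) = n] >]).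
    by exists (f (front B M)); apply/asboolP; exists M; split.
  have [m [Y XE [Yinf mY]]] := above_inf X Xinf.
  have YM : Y `<=` M by move=> y Yy; apply: XM; rewrite XE; right.
  have [BX MX] := frontM X Xinf XM; have [BY MY] := frontM Y Yinf YM.
  have tr : triangle (front B X) (front B Y).
    rewrite XE; apply: front_cons => //; first exact: subset_trans Mb.
    by apply/Mb/XM; rewrite XE; left.
  have := MP _ _ BX BY MX MY tr; rewrite ltnNge => /negP; apply; apply: nmin.
  by apply/asboolP; exists Y.
have {}MP s t Bs Bt sM tM st := bM s t Bs Bt sM tM st (MP s t Bs Bt sM tM st).
have [Bs sM] := frontM M Minf (@subset_refl _ _); set s := front B M in Bs sM.
pose k := foldr maxn 0 s.
have lek n : n \in s -> n <= k by exact: leq_foldr_maxn.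
have shift Z : infinite_set Z -> Z `<=` M -> (forall y, Z y -> k < y) ->
    f (front B Z) = iter (size s) S (f s).
  move=> Zinf ZM kZ.
  have sZ x y : x \in s -> Z y -> x < y by move=> /lek xk /kZ; apply: leq_ltn_trans.
  rewrite (@front_shift B Bbar nat f S M Z s) //; first by rewrite front_cat.
  exact: (barrier_sorted Bbar).
have [m [Y XE [Yinf mY]]] := above_inf _ (@infinite_above M k Minf).
have YM : Y `<=` M by move=> y Yy; have : (m |` Y) y; [right | rewrite -XE => -[]].
have kY y : Y y -> k < y by move=> Yy; have : (m |` Y) y; [right | rewrite -XE => -[]].
have [BY MY] := frontM Y Yinf YM.
have Xinf : infinite_set (m |` Y) by rewrite -XE; apply: infinite_above.
have XM : m |` Y `<=` M by rewrite -XE => n [].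
have [BX MX] := frontM _ Xinf XM.
have tr : triangle (front B (m |` Y)) (front B Y).
  apply: front_cons => //; first exact: subset_trans Mb.
  by apply/Mb/XM; left.
have := MP _ _ BX BY MX MY tr.
rewrite (shift _ Yinf YM kY) (shift _ Xinf XM); last by rewrite -XE => y [].
by move/eqP; rewrite eqn_leq ltnn andbF.
Qed.

End AlphaWqo.

(** * Decomposition of FAC posets *)

Lemma FAC_restr T (r : rel T) (C : set T) : FAC r -> FAC (restr r C).
Proof.
move=> fac S Santi.
have Sfin : finite_set (val @` S).
  by apply: fac => _ _ [x Sx <-] [y Sy <-] xy; congr val; apply: Santi.
apply: (sub_finite_set _ (finite_preimage (f := val) _ Sfin)).
  by move=> x Sx; exists x.
by move=> x y _ _; apply: val_setI.
Qed.

(** Ramsey's theorem for pairs, obtained from [nash_williams] for two-element sequences, extracts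
    from a bad sequence a descending sequence or an infinite antichain. *)
Lemma FAC_wqo T (r : rel T) : partial_order r -> FAC r -> no_descent r -> wqo r.
Proof.
move=> por fac nd f; apply: contrapT => bad.
have {}bad i j : i < j -> ~ r (f i) (f j) by move=> ij rij; apply: bad; exists i, j.
have [s t /= es et /prefixP[u e]|M [Minf _ MP]] := @nash_williams [set s | size s = 2]
  [set s | r (f (nth 0 s 1)) (f (nth 0 s 0))] [set: nat] _ infinite_nat.
  have := congr1 size e; rewrite size_cat es et; case: u e => // ->.
  by rewrite cats0.
have {}MP : (forall i j, M i -> M j -> i < j -> r (f j) (f i)) \/
            (forall i j, M i -> M j -> i < j -> ~ r (f j) (f i)).
  case: MP => MP; [left|right] => i j Mi Mj ij;
  by apply: (MP [:: i; j]); rewrite //= ?ij // => k; rewrite !inE => /orP[]/eqP->.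
have [m0 Mm0] := infinite_setN0 Minf.
have [m _|g [_ gM gS]] := @dependent_choice_in _ M (fun i j => i < j) m0 Mm0.
  by have [n Mn mn] := infinite_unbounded m Minf; exists n.
have gmono i j : i < j -> g i < g j.
  by apply: (@homo_ltn _ g (fun i j => i < j)) => // y x z; exact: ltn_trans.
case: MP => MP.
  have [n] := nd (f \o g); apply; split=> /=; first exact: MP.
  by move=> e; apply: (bad _ _ (gS n)); rewrite e por_refl.
have fgI i j : r (f (g i)) (f (g j)) -> i = j.
  by case: (ltngtP i j) => // [/gmono/bad|/gmono/(MP _ _ (gM j) (gM i))].
apply: infinite_nat; rewrite -(preimage_range (f \o g)).
apply: finite_preimage => [i j _ _ /= e|]; first by apply: fgI; rewrite e por_refl.
by apply: fac => _ _ [i _ <-] [j _ <-] /fgI->.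
Qed.

(** A partial decomposition, given as the graph of the map from a point to the maximum of its block,
    so that Zorn's lemma can use unions. The domain is an initial section; [graph_below] expresses
    that the order augments the lexicographic sum of the blocks. *)
Record decomposition_graph T (r : rel T) (S : set (T * T)) : Prop := {
  graph_fun : forall x d e, S (x, d) -> S (x, e) -> d = e;
  graph_down : forall x d y, S (x, d) -> r y x -> exists e, S (y, e);
  graph_le : forall x d, S (x, d) -> r x d;
  graph_top : forall x d, S (x, d) -> S (d, d);
  graph_below : forall x d e, S (x, d) -> S (e, e) -> r e d -> e <> d -> r e x;
  graph_convex : forall x y z d, S (x, d) -> S (z, d) -> r x y -> r y z -> S (y, d);
  graph_descent : forall f : nat -> T, (forall n, S (f n, f n)) ->
    exists n, ~ (r (f n.+1) (f n) /\ f n.+1 <> f n) }.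

(** A descending sequence of maxima never leaves the initial section of a member containing its
    first term, so well-foundedness passes to the union. *)
Lemma decomposition_graph_bigcup T (r : rel T) (F : set (set (T * T))) :
  partial_order r -> F `<=` decomposition_graph r -> total_on F subset ->
  decomposition_graph r (\bigcup_(S in F) S).
Proof.
move=> por FP Ftot.
have both u v : (\bigcup_(S in F) S) u -> (\bigcup_(S in F) S) v ->
    exists S, [/\ F S, S u & S v].
  move=> [S FS Su] [S' FS' Sv]; have [SS|SS] := Ftot _ _ FS FS'.
    by exists S'; split=> //; apply: SS.
  by exists S; split=> //; apply: SS.
split.
- by move=> x d e xd xe; have [S [/FP SP Sd Se]] := both _ _ xd xe; apply: (graph_fun SP Sd Se).
- move=> x d y [S FS Sd] yx; have [e Se] := graph_down (FP _ FS) Sd yx.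
  by exists e, S.
- by move=> x d [S /FP SP Sd]; apply: (graph_le SP Sd).
- by move=> x d [S FS Sd]; exists S => //; apply: (graph_top (FP _ FS) Sd).
- by move=> x d e xd ee; have [S [/FP SP Sd Se]] := both _ _ xd ee; apply: (graph_below SP Sd Se).
- move=> x y z d xd zd xy yz; have [S [FS Sx Sz]] := both _ _ xd zd.
  by exists S => //; apply: (graph_convex (FP _ FS) Sx Sz).
- move=> f fF; apply: contrapT => /forallNP nd.
  have {}nd n : r (f n.+1) (f n) /\ f n.+1 <> f n by exact: contrapT (nd n).
  have [S FS Sf0] := fF 0.
  have fS n : S (f n, f n).
    have le0 : r (f n) (f 0).
      elim: n => [|n IH]; first exact: por_refl.
      by apply: (por_trans por) IH; case: (nd n).
    have [e Se] := graph_down (FP _ FS) Sf0 le0.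
    have [S' [FS' Se' Sf']] : exists S', [/\ F S', S' (f n, e) & S' (f n, f n)].
      by apply: both; [exists S | exact: fF].
    by rewrite -{2}(graph_fun (FP _ FS') Se' Sf').
  by have [n] := graph_descent (FP _ FS) fS; apply; apply: nd.
Qed.

(** The new block consists of all uncovered points below [x], with maximum [x]. The last hypothesis
    is [graph_below] for this block. In a descending sequence [x] can only be the first term. *)
Lemma decomposition_graph_extend T (r : rel T) (S : set (T * T)) x :
    partial_order r -> decomposition_graph r S -> (forall d, ~ S (x, d)) ->
    (forall m y, S (m, m) -> r m x -> (forall d, ~ S (y, d)) -> r y x -> r m y) ->
  decomposition_graph r
    (S `|` [set u | [/\ u.2 = x, r u.1 x & forall d, ~ S (u.1, d)]]).
Proof.
move=> por SP xS mS; set S' := _ `|` _.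
have rr := por_refl por; have rt := por_trans por; have ra := por_anti por.
have S'S d : S' (d, d) -> d <> x -> S (d, d) by case=> //= -[->].
have notx y d : S (y, d) -> ~ r x y.
  by move=> Sy xy; have [e] := graph_down SP Sy xy; apply: xS.
split.
- move=> y d e [Sd|/= [-> yx yS]] [Se|/= [-> _ yS']] //; first exact: (graph_fun SP Sd Se).
    by case: (yS' _ Sd).
  by case: (yS _ Se).
- move=> y d z [Sd|/= [_ yx yS]] zy.
    by have [e Se] := graph_down SP Sd zy; exists e; left.
  have [[e Se]|nz] := pselect (exists e, S (z, e)); first by exists e; left.
  exists x; right; split=> //=; first exact: rt zy yx.
  by move=> e Se; apply: nz; exists e.
- by move=> y d [/(graph_le SP)//|/= [->]].
- move=> y d [/(graph_top SP)|/= [-> yx yS]]; first by left.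
  by right; split=> //=.
- move=> y d e [Sd|/= [-> yx yS]] ee ed eNd.
    have [ex|eNx] := pselect (e = x).
      by subst e; case: (notx _ _ (graph_top SP Sd) ed).
    have Se := S'S e ee eNx; exact: (graph_below SP Sd Se ed eNd).
  exact: mS (S'S e ee eNd) ed yS yx.
- move=> y1 y z d [Sd|/= [-> yx yS]].
    move=> [Sz|/= [dx _ _]] yy yz; first by left; exact: (graph_convex SP Sd Sz).
    by subst d; case: (xS _ (graph_top SP Sd)).
  move=> [Sz|/= [_ zx zS]] yy yz.
    by case: (xS _ (graph_top SP Sz)).
  right; split=> //=; first exact: rt yz zx.
  by move=> e Se; have [e'] := graph_down SP Se yy; apply: yS.
- move=> f fS'; apply: contrapT => /forallNP nd.
  have {}nd n : r (f n.+1) (f n) /\ f n.+1 <> f n by exact: contrapT (nd n).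
  have le0 n : r (f n) (f 0).
    elim: n => [|n IH]; first exact: rr.
    by apply: rt IH; case: (nd n).
  have fS n : S (f n.+1, f n.+1).
    apply: S'S (fS' _) _ => fx.
    have [fSn fN] := nd n; rewrite fx in fSn fN.
    have [/notx//|/= [fnx _ _]] := fS' n.
    by apply: fN.
  have [n] := graph_descent SP fS.
  by apply; apply: nd.
Qed.

(** The blocks are the fibres of [p], and [range p] is their set of maxima. *)
Lemma FAC_decomposition T (r : rel T) : partial_order r -> FAC r ->
  exists p : T -> T, [/\ forall x, r x (p x), forall x, p (p x) = p x,
    forall x d, p d = d -> r d (p x) -> d <> p x -> r d x,
    forall x y z, r x y -> r y z -> p x = p z -> p y = p x &
    wqo (restr r (range p))].
Proof.
move=> por fac.
have [|S [SP Smax]] := @Zorn_bigcup _ (decomposition_graph r).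
  by move=> F; apply: decomposition_graph_bigcup.
have Swqo : wqo (restr r [set d | S (d, d)]).
  apply: FAC_wqo; [exact: partial_order_restr | exact: FAC_restr |].
  move=> f; have [n nP] := graph_descent SP (fun n => valC (f n)).
  by exists n => -[fS fN]; apply: nP; split=> // /val_setI.
have total x : exists d, S (x, d).
  apply: contrapT => /forallNP xS.
  have [[y [yS ymS]]|nex] := pselect (exists y, (forall d, ~ S (y, d)) /\
      forall m z, S (m, m) -> r m y -> (forall d, ~ S (z, d)) -> r z y -> r m z).
    apply: (Smax _ _ (decomposition_graph_extend por SP yS ymS)).
    split; first by move=> u Su; left.
    by move=> /(_ (y, y)) H; apply: (yS y); apply: H; right; split=> //=; exact: por_refl.
  (* No uncovered point admits an extension. This gives uncovered points [y_0 >= y_1 >= ...] and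
     maxima [m_(n+1)] below [y_n] but not below [y_(n+1)]. If [m_(i+1) <= m_(j+1)] with [i < j],
     then [m_(i+1) <= y_j <= y_(i+1)], a contradiction. The second component of the initial pair is
     a dummy. *)
  have [||f [_ fV fP]] := @dependent_choice_in (T * T) (fun u => forall d, ~ S (u.1, d))
    (fun u v => [/\ r v.1 u.1, S (v.2, v.2), r v.2 u.1 & ~ r v.2 v.1]) (x, x).
  - exact: xS.
  - move=> [y m] /= yS; apply: contrapT => ny; apply: nex; exists y; split=> // m' z Sm my zS zy.
    by apply: contrapT => nmz; apply: ny; exists (z, m').
  have desc i k : r (f (i + k)).1 (f i).1.
    elim: k => [|k IH]; first by rewrite addn0 por_refl.
    by rewrite addnS; apply: (por_trans por) IH; case: (fP (i + k)).
  have mS n : [set d | S (d, d)] (f n.+1).2 by case: (fP n).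
  have [i [j [ij rij]]] := Swqo (fun n => subt (mS n)).
  have [_ _ _] := fP i; apply; have [_ _ mj _] := fP j.
  apply: (por_trans por) rij _; apply: (por_trans por) mj _.
  by rewrite -(subnKC ij) desc.
have /choice[p pP] := total.
have pid d : S (d, d) -> p d = d by move=> Sd; apply: (graph_fun SP (pP d) Sd).
have pfix d : p d = d -> S (d, d) by move=> {2}<-; exact: pP.
exists p; split.
- by move=> x; apply: (graph_le SP (pP x)).
- by move=> x; apply: pid; exact: (graph_top SP (pP x)).
- by move=> x d /pfix Sd; exact: (graph_below SP (pP x) Sd).
- move=> x y z xy yz pxz; apply: (graph_fun SP (pP y)).
  by apply: (graph_convex SP (pP x) _ xy yz); rewrite pxz.
- move=> f; have fS n : [set d | S (d, d)] (val (f n)).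
    by have [x _ <-] := valC (f n); exact: (graph_top SP (pP x)).
  by have [i [j [ij rij]]] := Swqo (fun n => subt (fS n)); exists i, j.
Qed.

Lemma exists_well_order T : exists w : rel T, well_order w.
Proof. by elim/Peq : T => T; have [w wP] := well_ordering_principle T; exists w. Qed.

Lemma FAC_alpha_FAC A (alpha : rel A) T (r : rel T) : partial_order r -> FAC r ->
    (forall C : set T, wqo (restr r C) -> alpha_wqo alpha (restr r C)) ->
  alpha_FAC alpha r.
Proof.
move=> por fac wqoP; split=> //.
have [p [ple pp pbelow pconv pwqo]] := FAC_decomposition por fac.
(* An arbitrary well-order of the maxima serves as the ordinal indexing the blocks. *)
have [w wP] := exists_well_order (range p).
exists (range p), w, val, (fun d => [set x | p x = val d]); split=> //; split.
  have -> : range (val : range p -> T) = range p.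
    apply/seteqP; split=> [_ [d _ <-]|d dp]; first exact: valC.
    by exists (subt dp).
  exact: wqoP.
split; last split.
- move=> d; have [x _ xd] := valC d; split.
    move=> y z t /= py pt yz zt; rewrite (pconv y z t) //.
    by rewrite py pt.
  split; first by rewrite inE /= -xd pp.
  by move=> y; rewrite inE /= => <-; exact: ple.
- move=> x; have px : range p (p x) by exists x.
  by exists (subt px); split=> //= d xd; apply: val_setI.
- move=> [d x] [e y] /asboolP[|[/= de dNe]].
    move=> [b [x' [y' [ex ey]]]].
    by rewrite ex ey.
  have px : p (val x) = val d := valC x; have py : p (val y) = val e := valC y.
  have xd : r (val x) (val d) by have := ple (val x); rewrite px.
  apply: (por_trans por) xd _; apply: pbelow; rewrite ?py //.
    by have [z _ <-] := valC d; rewrite pp.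
  by move=> /val_setI.
Qed.

(** * A poset that is not alpha-FAC *)

Lemma bounded_subsequence (h : nat -> nat) k : (forall i, h i < k) ->
  exists v (g : nat -> nat), {homo g : i j / i < j} /\ forall i, h (g i) = v.
Proof.
move=> hk; have [v vinf] : exists v, infinite_set (h @^-1` [set v]).
  apply: contrapT => /forallNP nv; apply: infinite_nat.
  apply: (@sub_finite_set _ _ (\bigcup_(v in `I_k) (h @^-1` [set v]))).
    by move=> i _; exists (h i) => //=; exact: hk.
  by apply: bigcup_finite => // v _; exact: contrapT (nv v).
have [m0 Mm0] := infinite_setN0 vinf.
have [m _|g [_ gM gS]] := @dependent_choice_in _ (h @^-1` [set v]) (fun i j => i < j) m0 Mm0.
  by have [n Mn mn] := infinite_unbounded m vinf; exists n.
exists v, g; split=> //.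
by apply: (@homo_ltn _ g (fun i j => i < j)) => // y x z; exact: ltn_trans.
Qed.

Lemma wqo_restr T (r : rel T) (C : set T) : wqo r -> wqo (restr r C).
Proof. by move=> w f; exact: w (val \o f). Qed.

Lemma well_order_chain T (r : rel T) (C : set T) : partial_order r -> wqo r ->
  {in C &, total r} -> well_order (restr r C).
Proof.
move=> por w Ctot; apply: no_descent_well_order.
  split; first exact: partial_order_restr.
  by move=> x y; apply: Ctot; exact: valP.
apply: wqo_no_descent; first exact: partial_order_restr.
exact: wqo_restr.
Qed.

Section Counterexample.
Variables (A : Type) (alpha : rel A) (alpha_ordinal : well_order alpha).

(** Pulls [semi] back along a constant map. *)
Lemma alpha_wqo_trivial T (r : rel T) : (forall x y, r x y) -> alpha_wqo alpha r.
Proof.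
move=> rT; apply: (@alpha_wqo_hom _ _ _ semi _ _ (fun=> 0)) => //.
exact: alpha_wqo_semi.
Qed.

Lemma alpha_wqo_sub T (r : rel T) (C D : set T) : C `<=` D ->
  alpha_wqo alpha (restr r D) -> alpha_wqo alpha (restr r C).
Proof.
by move=> CD; apply: (@alpha_wqo_hom _ _ _ _ _ _ (fun x => subt (CD _ (valC x)))).
Qed.

(** Take [y] minimal among the points whose lower section is not alpha-wqo and remove [y] itself
    from that section; if there is no such point, take the whole poset. *)
Lemma minimal_not_alpha_wqo T (r : rel T) : partial_order r -> wqo r ->
    ~ alpha_wqo alpha r ->
  exists C : set T, ~ alpha_wqo alpha (restr r C) /\
    forall y, C y -> alpha_wqo alpha (restr r [set x | C x /\ r x y]).
Proof.
move=> por w nw.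
have [[y0 y0P]|nS] := pselect (exists y, ~ alpha_wqo alpha (restr r [set x | r x y]));
  last first.
  exists setT; split.
    by apply: contra_not nw; apply: (@alpha_wqo_hom _ _ _ _ _ _ (@subt _ setT ^~ I)).
  move=> y _; apply: (@alpha_wqo_sub _ _ _ [set x | r x y]); first by move=> x [].
  by apply: contrapT => ny; apply: nS; exists y.
have nd := wqo_no_descent por w.
have [|y yP ymin] := @no_descent_min _ _
  [set y | ~ alpha_wqo alpha (restr r [set x | r x y])] por nd; first by exists y0.
exists [set x | r x y /\ x <> y]; split; last first.
  move=> z [zy zNy]; apply: (@alpha_wqo_sub _ _ _ [set x | r x z]); first by move=> x [].
  by apply: contrapT => /ymin/(_ zy).
move=> wC; apply: yP.
(* The point [y] goes on top of the rest. The values are 0 and 2 because 0 and 1 are incomparable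
   for [semi]. *)
pose h (x : [set x | r x y]) := if `[< val x = y >] then 2 else 0.
apply: (@alpha_wqo_partition _ _ alpha_ordinal _ _ _ semi h).
- exact: alpha_wqo_semi.
- move=> j; have [->|jN2] := eqVneq j 2.
    apply: alpha_wqo_trivial => u v.
    have hy (t : h @^-1` [set 2]) : val (val t) = y.
      by have := valC t; rewrite /h /=; case: asboolP.
    by rewrite /restr /= !hy por_refl.
  have hC (t : h @^-1` [set j]) : [set x | r x y /\ x <> y] (val (val t)).
    split; first exact: (valC (val t)).
    by move=> ty; have := valC t; rewrite /h /= ty asboolT // => j2; rewrite -j2 in jN2.
  by apply: (@alpha_wqo_hom _ _ _ _ _ _ (fun t => subt (hC t))) wC.
- move=> u v; rewrite /h /semi; case: asboolP => // _; case: asboolP => //= vy _ _.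
  by rewrite /restr /= vy; exact: (valC u).
Qed.

Variables (R : Type) (rR : rel R).
Hypotheses (porR : partial_order rR) (wqoR : wqo rR).

(* The points (n, None) are the maxima of the blocks; the block n consists of
   two incomparable copies of R below its maximum. *)
Let Q : Type := nat * option (bool * R).

Definition block_le (a b : option (bool * R)) : bool :=
  match a, b with
  | _, None => true
  | None, Some _ => false
  | Some (c, x), Some (d, y) => (c == d) && rR x y
  end.

Definition sum_le : rel Q :=
  fun u v => (u.1 == v.1) && block_le u.2 v.2 || (u.1.+2 <= v.1).

(** Putting the maximum of block n below that of block n+1 forces the whole block n below the
    latter; these are the only new relations. *)
Definition skew_le : rel Q :=
  fun u v => if v.2 is None then u.1 <= v.1 else sum_le u v.

Lemma block_le_por : partial_order block_le.
Proof.
have [[rr rt] ra] := porR.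
split; first split.
- by move=> [[c x]|] //=; rewrite eqxx rr.
- move=> [[d y]|] [[c x]|] [[e z]|] //= /andP[/eqP-> xy] /andP[/eqP-> yz].
  by rewrite eqxx (rt y).
- move=> [[c x]|] [[d y]|] //= /andP[/andP[/eqP-> xy] /andP[_ yx]].
  by rewrite (ra x y) // xy.
Qed.

Lemma sum_le_fst u v : sum_le u v -> u.1 <= v.1.
Proof. by case/orP => [/andP[/eqP->]|/ltnW/ltnW]. Qed.

Lemma skew_le_fst u v : skew_le u v -> u.1 <= v.1.
Proof. by rewrite /skew_le; case: v.2 => [?|] // /sum_le_fst. Qed.

Lemma sum_skew_le : augments sum_le skew_le.
Proof. by move=> u v uv; rewrite /skew_le; case: v.2 (sum_le_fst uv). Qed.

Lemma sum_le_por : partial_order sum_le.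
Proof.
have [[rr rt] ra] := block_le_por.
have trans : transitive sum_le.
  move=> v u w /orP[/andP[/eqP uv buv]|uv] /orP[/andP[/eqP vw bvw]|vw]; rewrite /sum_le.
  - by rewrite uv vw eqxx (rt _ _ _ buv bvw).
  - by rewrite uv vw orbT.
  - by rewrite -vw uv orbT.
  - by rewrite (leq_trans uv) ?orbT // ltnW // ltnW.
split; first split=> //.
  by move=> u; rewrite /sum_le eqxx rr.
move=> [m a] [n b] /andP[ab ba].
have e : m = n by apply/eqP; rewrite eqn_leq (sum_le_fst ab) (sum_le_fst ba).
move: ab ba; rewrite /sum_le /= e eqxx /= !(ltnNge n.+1) leqnSn !orbF => ab ba.
by rewrite (ra a b) // ab.
Qed.

Lemma skew_le_por : partial_order skew_le.
Proof.
have [[rr rt] ra] := sum_le_por.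
split; first split.
- by move=> [n [a|]]; rewrite /skew_le /= ?rr.
- move=> [n b] [m a] [k [c|]] ab bc; last first.
    by rewrite /skew_le /=; apply: leq_trans (skew_le_fst ab) (skew_le_fst bc).
  move: ab bc; rewrite /skew_le /=; case: b => [b|] ab bc; first exact: rt bc.
  move: bc; rewrite /sum_le /= andbF /= => nk.
  by rewrite (leq_trans _ nk) ?orbT // !ltnS.
- move=> [m a] [n b] /andP[ab ba].
  have e : m = n by apply/eqP; rewrite eqn_leq (skew_le_fst ab) (skew_le_fst ba).
  move: ab ba; rewrite /skew_le /= e.
  case: a b => [a|] [b|] //; rewrite /sum_le /= ?eqxx /= !(ltnNge n.+1) ?leqnSn ?orbF //= => ab ba.
  by apply: ra; rewrite /sum_le /= eqxx /= ab ba.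
Qed.

Lemma sum_le_wqo : wqo sum_le.
Proof.
move=> f; apply: contrapT => bad.
have {}bad i j : i < j -> ~ sum_le (f i) (f j) by move=> ij s; apply: bad; exists i, j.
(* Points two or more blocks higher would lie above [f 0]. *)
have bnd i : (f i).1 < (f 0).1.+2.
  case: i => [|i]; first exact: ltnW.
  rewrite ltnNge; apply/negP => le; apply: (bad 0 i.+1) => //.
  by rewrite /sum_le le orbT.
have [n [g [gm gn]]] := bounded_subsequence bnd.
(* The maximum is coded by 0 and the two copies by 1 and 2, whence the bound 3 below. A second
   pigeonhole fixes the copy, and a repeated maximum would be a good pair. *)
pose code (a : option (bool * R)) := if a is Some (c, _) then c.+1 else 0.
have [|v [k [km kv]]] := @bounded_subsequence (fun i => code (f (g i)).2) 3.
  by move=> i; rewrite /code; case: (_).2 => [[[] ?]|].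
have same i j : i < j -> ~ block_le (f (g (k i))).2 (f (g (k j))).2.
  move=> /km/gm ij bij; apply: (bad _ _ ij); rewrite /sum_le bij andbT.
  by rewrite (gn (k i)) (gn (k j)) eqxx.
have /choice[x xP] : forall i, exists y : R, exists c : bool,
    (f (g (k i))).2 = Some (c, y) /\ c.+1 = v.
  move=> i; have := kv i; rewrite /code; case E : (_).2 => [[c y]|] cv.
    by exists y, c.
  case: (same i i.+1 (ltnSn i)); rewrite E.
  have := kv i.+1; rewrite -cv /code; case: (f (g (k i.+1))).2 => [[]|] //.
have [i [j [ij rij]]] := wqoR x.
have [[c [ic cv]] [d [jd dv]]] := (xP i, xP j).
apply: (same i j ij); rewrite ic jd /= rij andbT; apply/eqP.
by move: cv; rewrite -dv => -[]; case: (c) (d) => -[].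
Qed.

(** The blocks themselves form the decomposition; their maxima are ordered as in [semi]. *)
Lemma sum_le_alpha_FAC : alpha_FAC alpha sum_le.
Proof.
split; first exact/wqo_FAC/sum_le_wqo.
exists nat, leq, (fun n => (n, None)), (fun n => [set u | u.1 = n]); split.
  exact: well_order_leq.
split; last split; last split.
- apply: (@alpha_wqo_hom _ _ _ semi _ _ (fun u => (val u).1)); last exact: alpha_wqo_semi.
  move=> u v; have [i _ ui] := valC u; have [j _ vj] := valC v.
  rewrite /restr /= -ui -vj /semi /sum_le /= => /orP[/eqP->|->]; last by rewrite orbT.
  by rewrite eqxx.
- move=> n; split.
    move=> u v w /= un wn /sum_le_fst uv /sum_le_fst vw; apply/eqP.
    by rewrite eqn_leq -{1}wn vw -un.
  split; first by rewrite inE.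
  by move=> u; rewrite inE /= => un; rewrite /sum_le /= un eqxx; case: u.2 => [[]|].
- by move=> u; exists u.1; split.
- move=> [m x] [n y] /asboolP[|[/= mn mNn]].
    by move=> [k [x' [y' [ex ey]]]]; rewrite ex ey.
  have xm : (val x).1 = m := valC x; have yn : (val y).1 = n := valC y.
  move: mn; rewrite /sum_le /= xm yn => /orP[/andP[/eqP//]|->].
  by rewrite orbT.
Qed.

Hypothesis notwR : ~ alpha_wqo alpha rR.
Hypothesis boundedR : forall y, alpha_wqo alpha (restr rR [set x | rR x y]).

Lemma skew_le_not_alpha_FAC : ~ alpha_FAC alpha skew_le.
Proof.
move=> [_ [zeta [rzeta [p [Z [_ [pwqo [Zconv [Zpart Zsum]]]]]]]]].
have /choice[b bP] : forall u, exists d, Z d u.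
  by move=> u; have [d [Zd _]] := Zpart u; exists d.
have bu d u : Z d u -> b u = d.
  by move=> Zd; have [e [_ eu]] := Zpart u; rewrite -(eu _ Zd) -(eu _ (bP u)).
have Zp d : Z d (p d) by have [_ [+ _]] := Zconv d; rewrite inE.
have bp d : b (p d) = d by exact: bu.
have le_p u : skew_le u (p (b u)).
  by have [_ [_]] := Zconv (b u); apply; rewrite inE; exact: bP.
have conv u v w : skew_le u v -> skew_le v w -> b u = b w -> b v = b u.
  move=> uv vw e; apply: bu; have [cv _] := Zconv (b u); apply: (cv u v w) => //.
  by rewrite e; exact: bP.
have below u v : skew_le (p (b u)) (p (b v)) -> b u <> b v -> skew_le u v.
  move=> puv buv.
  apply: (Zsum (existT _ (b u) (subt (bP u))) (existT _ (b v) (subt (bP v)))).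
  by apply/asboolP; right.
have trans := por_trans skew_le_por.
(* Otherwise the copy of [R] would be split into alpha-wqo pieces along the alpha-wqo set of maxima,
   making [R] alpha-wqo. *)
have big n c : exists d, ~ alpha_wqo alpha (restr rR [set x | b (n, Some (c, x)) = d]).
  apply: contrapT => /forallNP small; apply: notwR.
  have hx x : range p (p (b (n, Some (c, x)))) by exists (b (n, Some (c, x))).
  apply: (@alpha_wqo_partition _ _ alpha_ordinal _ _ _ _ (fun x => subt (hx x)) pwqo).
    move=> j; have [d _ dj] := valC j; have := contrapT (small d).
    have sub (x : (fun x => subt (hx x)) @^-1` [set j]) :
        [set x | b (n, Some (c, x)) = d] (val x).
      have /= := valC x => /(congr1 val) /= xj.
      by rewrite -(bp (b _)) xj -dj bp.
    by apply: (@alpha_wqo_hom _ _ _ _ _ _ (fun x => subt (sub x))).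
  move=> x y /below le ne.
  have := le _; rewrite /skew_le /sum_le /= !eqxx /= ltnNge leqnSn orbF; apply.
  by move=> e; apply: ne; apply: val_setI; rewrite /= e.
(* The maximum of a class with a large part in the copy [c] cannot lie in that copy, since lower
   sections of [R] are alpha-wqo. It is therefore above [(n, None)], which joins the class by
   convexity. *)
have top n c : exists x, b (n, Some (c, x)) = b (n, None).
  have [d dP] := big n c.
  have [x xd] : exists x, b (n, Some (c, x)) = d.
    apply: contrapT => /forallNP nx; apply: dP; apply: alpha_wqo_trivial => x.
    by have /nx := valC x.
  suff np : skew_le (n, None) (p d).
    exists x; apply/esym; rewrite -(conv (n, Some (c, x)) (n, None) (p d)) ?bp //.
    by rewrite /skew_le /=.
  have := le_p (n, Some (c, x)); rewrite xd.
  case pd : (p d) => [m [[e y]|]]; rewrite /skew_le /sum_le //= => /orP[/andP[/eqP nm /andP[/eqP ce xy]]|nm];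
    last by rewrite nm orbT.
  case: dP; apply: (@alpha_wqo_sub _ _ _ [set x | rR x y]); last exact: boundedR.
  move=> z /= zd; have := le_p (n, Some (c, z)); rewrite zd pd.
  by rewrite /skew_le /sum_le /= nm ltnNge leqnSn orbF => /andP[_ /andP[]].
(* Here two copies per block are used. A class maximum inside copy [c] of block [i] would lie below
   the maximum of the class of [(i, None)]. That class contains a point of the other copy, so
   comparable maxima would make points of the two copies comparable. *)
have top_none n : (p (b (n, None))).2 = None.
  case pn : (p (b (n, None))) => [i [[c y]|]] //.
  have := le_p (n, None); rewrite pn /skew_le /sum_le /= andbF /= => ni.
  have b_t : b (i, Some (c, y)) = b (n, None) by rewrite -pn bp.
  have ti : skew_le (i, Some (c, y)) (i, None) by rewrite /skew_le /=.
  have bNb : b (n, None) <> b (i, None).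
    move=> e; have := le_p (i, None); rewrite -e pn /skew_le /sum_le /= andbF /=.
    by rewrite ltnNge leqnSn.
  have [x xi] := top i (~~ c).
  have := below (i, Some (c, y)) (i, Some (~~ c, x)).
  rewrite b_t xi pn => /(_ (trans _ _ _ ti (le_p _)) bNb).
  by rewrite /skew_le /sum_le /= eqxx ltnNge leqnSn orbF; case: (c).
(* Now [(m, None)] is the maximum of its class, so the class of [(m.+1, None)] is a different one
   with a larger maximum. Both classes meet the copies of [R] in their blocks, where blocks [m] and
   [m.+1] are incomparable. *)
case pm : (p (b (0, None))) (top_none 0) => [m a] /= am; subst a.
have bm : b (m, None) = b (0, None) by rewrite -pm bp.
have {}pm : p (b (m, None)) = (m, None) by rewrite bm.
have mm : skew_le (m, None) (m.+1, None) by rewrite /skew_le /= leqnSn.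
have bNb : b (m, None) <> b (m.+1, None).
  by move=> e; have := le_p (m.+1, None); rewrite -e pm /skew_le /= ltnn.
have [[x xm] [y ym]] := (top m true, top m.+1 true).
have := below (m, Some (true, x)) (m.+1, Some (true, y)).
rewrite xm ym pm => /(_ (trans _ _ _ mm (le_p _)) bNb).
by rewrite /skew_le /sum_le /= ltnn orbF (ltn_eqF (ltnSn m)).
Qed.

End Counterexample.

(** A wqo poset that is not alpha-wqo would make [skew_le] alpha-FAC through the augmentation
    hypothesis. The chains of [sum_le] are in [G0], being well-ordered. *)
Lemma wqo_alpha_wqo A (alpha : rel A) (G0 : order_class) : well_order alpha ->
    (forall T (r : rel T), well_order r -> G0 T r) ->
    closed_under_augmentations (alpha_FAC_chains alpha G0) ->
  forall T (r : rel T), partial_order r -> wqo r -> alpha_wqo alpha r.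
Proof.
move=> wo G0wo Gaug T r por w; apply: contrapT => nw.
have [C [nC Cb]] := minimal_not_alpha_wqo wo por w nw.
have porC := partial_order_restr C por; have wC : wqo (restr r C) by exact: wqo_restr.
apply: (@skew_le_not_alpha_FAC _ _ wo _ _ porC nC) => [y|].
  have Cx (x : [set x : C | restr r C x y]) : [set x | C x /\ r x (val y)] (val (val x)).
    by split; [exact: valC | exact: (valC x)].
  by apply: (@alpha_wqo_hom _ _ _ _ _ _ (fun x => subt (Cx x))) (Cb _ (valC y)).
suff [] : alpha_FAC_chains alpha G0 (skew_le (restr r C)) by [].
apply: (Gaug _ (sum_le (restr r C))); last exact: sum_skew_le.
  split; first exact: sum_le_por.
    exact: sum_le_alpha_FAC.
  move=> D Dtot; apply: G0wo; apply: well_order_chain => //.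
    exact: sum_le_por.
  exact: sum_le_wqo.
exact: skew_le_por.
Qed.

(** * Isomorphisms and lexicographic sums *)

Lemma order_iso_surj T T' (r : rel T) (r' : rel T') (f : T -> T') :
  injective f -> (forall y, exists x, f x = y) -> {mono f : x y / r x y >-> r' x y} ->
  order_iso r r'.
Proof.
move=> finj /choice[g gP] fm; exists f => //.
by exists g => // x; apply: finj; rewrite gP.
Qed.

Lemma order_iso_sym T T' (r : rel T) (r' : rel T') : order_iso r r' -> order_iso r' r.
Proof.
move=> [f [g fK gK] fm]; exists g; first by exists f.
by move=> x y; rewrite -fm !gK.
Qed.

Lemma existT_inj J (X : J -> Type) j (x y : X j) : existT X j x = existT X j y -> x = y.
Proof.
move=> e; have := projT2_eq e.
by rewrite (Prop_irrelevance (projT1_eq e) (erefl j)).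
Qed.

Section Lexsum.
Variables (J : Type) (rJ : rel J) (X : J -> Type) (rX : forall j, rel (X j)).

Lemma lexsum_same j (x y : X j) :
  lexsum rJ rX (existT X j x) (existT X j y) = rX x y.
Proof.
apply/asboolP/idP => [[[k [x' [y' [ex ey kxy]]]]|[_ []//]]|xy].
  have jk : j = k := congr1 (@tag _ _) ex; subst k.
  by rewrite (existT_inj ex) (existT_inj ey).
by left; exists j, x, y.
Qed.

Lemma lexsum_diff u v : tag u <> tag v -> lexsum rJ rX u v = rJ (tag u) (tag v).
Proof.
move=> uv; apply/asboolP/idP => [[[k [x' [y' [ex ey kxy]]]]|[]//]|]; last by right.
by case: uv; rewrite ex ey.
Qed.

Lemma lexsum_tag u v : reflexive rJ -> lexsum rJ rX u v -> rJ (tag u) (tag v).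
Proof.
move=> rr; have [->|uv] := pselect (tag u = tag v); first by rewrite rr.
by rewrite lexsum_diff.
Qed.

Lemma lexsum_partial_order :
  partial_order rJ -> (forall j, partial_order (@rX j)) -> partial_order (lexsum rJ rX).
Proof.
move=> porJ porX; have [[rr rt] ra] := porJ.
split; first split.
- by move=> [j x]; rewrite lexsum_same (por_refl (porX j)).
- move=> [k y] [j x] [l z] xy yz.
  have jk := lexsum_tag rr xy; have kl := lexsum_tag rr yz; rewrite /= in jk kl.
  have [jl|jl] := pselect (j = l); last by rewrite lexsum_diff //=; exact: rt jk kl.
  subst l; have kj : k = j by apply: ra; rewrite kl jk.
  by subst k; move: xy yz; rewrite !lexsum_same; apply: (por_trans (porX j)).
- move=> [j x] [k y] /andP[xy yx].
  have jk : j = k by apply: ra; rewrite (lexsum_tag rr xy) (lexsum_tag rr yx).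
  subst k; move: xy yx; rewrite !lexsum_same => xy yx.
  by rewrite (por_anti (porX j) (x := x) (y := y)) // xy.
Qed.

Lemma lexsum_FAC : reflexive rJ -> FAC rJ -> (forall j, FAC (@rX j)) -> FAC (lexsum rJ rX).
Proof.
move=> rr facJ facX C Canti.
have Jfin : finite_set [set tag u | u in C].
  apply: facJ => _ _ [u Cu <-] [v Cv <-] uv; apply: contrapT => uNv; apply: uNv.
  have [//|uNv] := pselect (tag u = tag v).
  by rewrite (Canti u v Cu Cv) // lexsum_diff.
apply: (@sub_finite_set _ _ (\bigcup_(j in [set tag u | u in C])
    (existT X j @` [set x | C (existT X j x)]))).
  by move=> [j x] Cx; exists j; [exists (existT X j x) | exists x].
apply: bigcup_finite => // j _; apply: finite_image; apply: facX => x y Cx Cy xy.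
by apply: existT_inj; apply: Canti => //; rewrite lexsum_same.
Qed.

End Lexsum.

(** The lexicographic sum of the fibres of [h], carried by [T] itself so that [r] can be an
    augmentation of it. *)
Definition fiber_sum T (r : rel T) J (rJ : rel J) (h : T -> J) : rel T := fun x y =>
  `[< (h x = h y /\ r x y) \/ (rJ (h x) (h y) /\ h x <> h y) >].

Lemma fiber_sum_iso T (r : rel T) J (rJ : rel J) (h : T -> J) :
  order_iso (lexsum rJ (fun j => restr r (h @^-1` [set j]))) (fiber_sum r rJ h).
Proof.
apply: (@order_iso_surj _ _ _ _ (fun u : {j : J & h @^-1` [set j]} => val (tagged u))).
- move=> [j x] [k y] /= xy; have xj : h (val x) = j := valC x; have yk : h (val y) = k := valC y.
  have jk : j = k := etrans (esym xj) (etrans (congr1 h xy) yk).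
  by subst k; rewrite (val_setI xy).
- by move=> x; exists (existT _ (h x) (subt (C := h @^-1` [set h x]) (x := x) erefl)).
- move=> [j x] [k y] /=; have xj : h (val x) = j := valC x; have yk : h (val y) = k := valC y.
  have [jk|jk] := pselect (j = k).
    subst k; rewrite lexsum_same /fiber_sum xj yk.
    by apply/asboolP/idP => [[[]|[]]|xy] //; left.
  rewrite lexsum_diff //= /fiber_sum xj yk.
  by apply/asboolP/idP => [[[]|[]]|xy] //; right.
Qed.

Lemma order_iso_restr T T' (r : rel T) (r' : rel T') (g : T' -> T) :
  injective g -> {mono g : x y / r' x y >-> r x y} -> order_iso r' (restr r (range g)).
Proof.
move=> ginj gm; have gr x : range g (g x) by exists x.
apply: (@order_iso_surj _ _ _ _ (fun x => subt (gr x))) => //.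
- by move=> x y /(congr1 val) /= /ginj.
- by move=> y; have [x _ xy] := valC y; exists x; apply: val_setI.
Qed.

Lemma restr_iso T T' (r : rel T) (r' : rel T') (f : T -> T') (C : set T') :
  bijective f -> {mono f : x y / r x y >-> r' x y} ->
  order_iso (restr r (f @^-1` C)) (restr r' C).
Proof.
move=> [g fK gK] fm; have fC (x : f @^-1` C) : C (f (val x)) := valC x.
apply: (@order_iso_surj _ _ _ _ (fun x => subt (fC x))).
- by move=> x y /(congr1 val) /= /(can_inj fK) /val_setI.
- move=> y; have gy : (f @^-1` C) (g (val y)) by rewrite /= gK; exact: valC.
  by exists (subt gy); apply: val_setI; rewrite /= gK.
- by move=> x y; rewrite /restr /= fm.
Qed.

(** * The closure *)

Section Closure.
Variables (A : Type) (alpha : rel A) (G0 : order_class).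
Hypotheses (alpha_ordinal : well_order alpha)
  (alpha_infinite : infinite_set [set: A]) (G0_reasonable : reasonable G0)
  (G0_well_orders : forall (T : Type) (r : rel T), well_order r -> G0 r)
  (G0_sums : closed_under_sums G0).

Local Notation cl := (alpha_cl alpha G0).

Definition admissible J (rJ : rel J) : Prop :=
  [\/ partial_order rJ /\ alpha_wqo alpha rJ,
      partial_order rJ /\ alpha_wqo alpha (reversal rJ) | G0 rJ].

(** A restricted sum is a sum of restrictions along the same index poset, with empty summands
    allowed, so the index stays admissible. *)
Lemma cl_restr T (r : rel T) (C : set T) : cl r -> cl (restr r C).
Proof.
move=> clr; elim: clr C => {T r}.
- by move=> T r Gr C; apply/alpha_cl_base/(reasonable_restr G0_reasonable).
- move=> T T' r r' [f [g fK gK] fm] _ IH C.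
  by apply: alpha_cl_iso (IH (f @^-1` C)); apply: restr_iso fm; exists g.
- move=> J rJ X rX adm _ IH C.
  pose C' j := [set x | C (existT X j x)].
  apply: alpha_cl_iso (alpha_cl_sum adm (fun j => IH j (C' j))).
  have fC (u : {j & C' j}) : C (existT X (tag u) (val (tagged u))).
    by case: u => j x; exact: (valC x).
  apply: (@order_iso_surj _ _ _ _ (fun u => subt (fC u))).
  - move=> [j x] [k y] /(congr1 val) /= e; have jk : j = k := congr1 (@tag _ _) e.
    by subst k; have /val_setI-> := existT_inj e.
  - move=> [[j x] Cx]; have C'x : C' j x by exact: set_mem.
    by exists (existT _ j (subt C'x)); apply: val_setI.
  - move=> [j x] [k y]; rewrite /restr /=; have [jk|jk] := pselect (j = k).
      by subst k; rewrite !lexsum_same.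
    by rewrite !lexsum_diff.
- move=> T r r' _ IH por rr' C; apply: (alpha_cl_augm (IH C)).
    exact: partial_order_restr.
  by move=> x y; apply: rr'.
Qed.

Lemma cl_embed T T' (r : rel T) (r' : rel T') (g : T' -> T) :
  injective g -> {mono g : x y / r' x y >-> r x y} -> cl r -> cl r'.
Proof.
move=> ginj gm /(@cl_restr _ _ (range g)).
by apply: alpha_cl_iso; apply/order_iso_sym/order_iso_restr.
Qed.

Lemma cl_sub T (r : rel T) (C D : set T) : C `<=` D -> cl (restr r D) -> cl (restr r C).
Proof.
move=> CD; apply: (@cl_embed _ _ _ _ (fun x => subt (CD _ (valC x)))) => //.
by move=> x y /(congr1 val) /= /val_setI.
Qed.

Lemma cl_partition T (r : rel T) J (rJ : rel J) (h : T -> J) :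
    partial_order r -> admissible rJ ->
    (forall j, cl (restr r (h @^-1` [set j]))) ->
    (forall x y, rJ (h x) (h y) -> h x <> h y -> r x y) -> cl r.
Proof.
move=> por adm clh hr; apply: (@alpha_cl_augm _ _ _ _ (fiber_sum r rJ h)) => //.
  exact: alpha_cl_iso (fiber_sum_iso r rJ h) (alpha_cl_sum adm clh).
by move=> x y /asboolP[[_ //]|[]]; exact: hr.
Qed.

(** * FAC posets with chains in the base class belong to the closure *)

Hypothesis wqoW : forall T (r : rel T), partial_order r -> wqo r -> alpha_wqo alpha r.

Lemma cl_subsingleton T (r : rel T) (C : set T) : partial_order r ->
  (forall x y, C x -> C y -> x = y) -> cl (restr r C).
Proof.
move=> por C1; apply/alpha_cl_base/G0_well_orders/no_descent_well_order.
  split; first exact: partial_order_restr.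
  move=> x y; have -> : x = y by apply/val_setI/C1; exact: valC.
  by rewrite /restr /= (por_refl por).
by move=> f; exists 0 => -[_]; apply; apply/val_setI/C1; exact: valC.
Qed.

(** The order augments the disjoint sum of two pieces, indexed by the two-element antichain. *)
Lemma cl_setU T (r : rel T) (C D : set T) : partial_order r ->
  cl (restr r C) -> cl (restr r D) -> cl (restr r (C `|` D)).
Proof.
move=> por clC clD.
pose h (x : C `|` D) := `[< C (val x) >].
apply: (@cl_partition _ _ bool eq_op h); first exact: partial_order_restr.
- apply: Or31; split.
    by split; [split=> [x|y x z /eqP->//]|move=> x y /andP[/eqP]].
  apply: wqoW.
    by split; [split=> [x|y x z /eqP->//]|move=> x y /andP[/eqP]].
  move=> f; have [e|n01] := eqVneq (f 0) (f 1); first by exists 0, 1; rewrite e.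
  have [e|n12] := eqVneq (f 1) (f 2); first by exists 1, 2; rewrite e.
  exists 0, 2; split=> //; move: n01 n12.
  by case: (f 0); case: (f 1); case: (f 2).
- move=> b; have split_CD (y : C `|` D) : (if h y then C else D) (val y).
    by rewrite /h; case: asboolP => // nCy; case: (valC y).
  have inCD (x : h @^-1` [set b]) : (if b then C else D) (val (val x)).
    by have xb : h (val x) = b := valC x; have := split_CD (val x); rewrite xb.
  have clb : cl (restr r (if b then C else D)) by case: (b).
  apply: (@cl_embed _ _ _ _ (fun x => subt (inCD x))) clb => //.
  by move=> x y /(congr1 val) /= /val_setI/val_setI.
- by move=> x y /eqP.
Qed.

(** The poset is cut into blocks with a maximum, and each block, decomposed for the reversed order,
    into pieces with a minimum. Each piece lies in an interval. *)
Lemma cl_intervals T (r : rel T) : partial_order r -> FAC r ->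
  (forall x y, r x y -> cl (restr r [set z | r x z /\ r z y])) -> cl r.
Proof.
move=> por fac clI.
have [p [ple pp pbelow _ pwqo]] := FAC_decomposition por fac.
have prange x : range p (p x) by exists x.
apply: (@cl_partition _ _ _ (restr r (range p)) (fun x => subt (prange x)) por).
- apply: Or31; split; first exact: partial_order_restr.
  by apply: wqoW => //; exact: partial_order_restr.
- move=> d; set F := _ @^-1` _.
  have Fd (x : F) : p (val x) = val d by have /= <- := valC x.
  have porF := partial_order_restr F por.
  have facF : FAC (reversal (restr r F)).
    by move=> C Canti; apply: (FAC_restr fac) => x y Cx Cy xy; apply/esym; apply: Canti.
  have [q [qle qq qbelow _ qwqo]] := FAC_decomposition (partial_order_reversal porF) facF.
  have qrange x : range q (q x) by exists x.
  apply: (@cl_partition _ _ _ (restr (restr r F) (range q)) (fun x => subt (qrange x)) porF).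
  + apply: Or32; split; first exact: partial_order_restr.
    by apply: wqoW; [exact/partial_order_reversal/partial_order_restr | exact: qwqo].
  + move=> e; have [e' _ ee'] := valC e.
    have qx (x : (fun x => subt (qrange x)) @^-1` [set e]) : q (val x) = val e.
      have xe : subt (qrange (val x)) = e := valC x.
      exact: (f_equal (@sval _ _) xe).
    have le_d (x : F) : r (val x) (val d) by rewrite -(Fd x); exact: ple.
    have inI (x : (fun x => subt (qrange x)) @^-1` [set e]) :
        [set z | r (val (val e)) z /\ r z (val d)] (val (val x)).
      have qle_x := qle (val x); rewrite (qx x) in qle_x.
      by split; [exact: qle_x | exact: le_d].
    apply: (@cl_embed _ _ _ _ (fun x => subt (inI x))) (clI _ _ (le_d (val e))) => //.
    by move=> x y /(congr1 val) /= /val_setI/val_setI.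
  + move=> x y /= qxy qN; apply: (por_trans por) (qle y).
    apply: (qbelow x (q y)) => //.
    by move=> e; apply: qN; apply: val_setI; rewrite /= e.
- move=> x y pxy pN; apply: (por_trans por) (ple x) _; apply: pbelow => //.
  by move=> e; apply: pN; apply: val_setI; rewrite /= e.
Qed.

(* On a maximal chain M, call l and k equivalent when the interval between them is
   in the closure.  If z is incomparable to two points of M, then so is every point
   between them; hence the points of M incomparable to z lie in one class, which
   maps the poset to the chain of classes. *)
Lemma cl_perp T (r : rel T) : partial_order r -> FAC r ->
    (forall C : set T, {in C &, total r} -> G0 (restr r C)) ->
    (forall y, cl (restr r [set z | ~ r y z /\ ~ r z y])) -> cl r.
Proof.
move=> por fac chains clperp.
have rr := por_refl por; have rt := por_trans por; have ra := por_anti por.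
have [[t0]|nT] := pselect (inhabited T); last first.
  apply/alpha_cl_base/G0_well_orders => C [x].
  by case: nT.
have [|M [Mtot Mmax]] :=
  @Zorn_bigcup T [set C | forall x y, C x -> C y -> r x y \/ r y x].
  move=> F FP Ftot x y [C FC Cx] [D FD Dy]; have [CD|DC] := Ftot _ _ FC FD.
    by apply: (FP _ FD) => //; apply: CD.
  by apply: (FP _ FC) => //; apply: DC.
(* By maximality of [M], a point outside [M] is incomparable to some point of [M]. *)
have /choice[g gP] : forall y, exists m, M m /\ (m = y \/ ~ r m y /\ ~ r y m).
  move=> y; have [My|nMy] := pselect (M y); first by exists y; split=> //; left.
  apply: contrapT => nm; apply: (Mmax (M `|` [set y])).
    by split; [move=> x Mx; left | move=> /(_ y) H; apply: nMy; apply: H; right].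
  have comp m : M m -> r m y \/ r y m.
    move=> Mm; have [|nmy] := pselect (r m y); first by left.
    have [|nym] := pselect (r y m); first by right.
    by case: nm; exists m; split=> //; right.
  move=> a b [Ma|->] [Mb|->]; [exact: Mtot|exact: comp| |by left].
  by case: (comp b Mb); [right|left].
have gM y : M (g y) by case: (gP y).
pose btw l k := [set z | r l z /\ r z k \/ r k z /\ r z l].
pose perp y := [set z | ~ r y z /\ ~ r z y].
pose E l k := cl (restr r (btw l k)).
have E_sub l k (C : set T) : E l k -> C `<=` btw l k -> cl (restr r C).
  by move=> Elk Csub; exact: cl_sub Elk.
have E_refl l : E l l.
  apply: cl_subsingleton => // x y xl yl.
  have el z : btw l l z -> z = l by case=> -[a b]; apply: ra; rewrite a b.
  by rewrite (el x xl) (el y yl).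
have E_sym l k : E l k -> E k l by move=> Elk; apply: E_sub Elk _ => z [|]; [right|left].
(* Points between [l] and [m] are comparable to [k], and then lie in one of the two given intervals,
   or belong to [perp k]. *)
have E_trans l k m : E l k -> E k m -> E l m.
  move=> Elk Ekm; apply: (@cl_sub _ _ _ ((btw l k `|` btw k m) `|` perp k)); last first.
    by apply: cl_setU => //; [exact: cl_setU | exact: clperp].
  move=> z zlm; have [kz|nkz] := pselect (r k z); first by
    case: zlm => -[a b]; [left; right; left | left; left; right].
  have [zk|nzk] := pselect (r z k); last by right.
  by case: zlm => -[a b]; [left; left; left | left; right; right].
(* An interval from [x] to [y] inside a class is covered by [perp (g x)], [perp (g y)] and the
   interval between [g x] and [g y]. *)
have cl_block i : cl (restr r [set x | E (g x) i]).
  set F := [set x | _]; apply: cl_intervals.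
  - exact: partial_order_restr.
  - exact: FAC_restr.
  move=> x y xy.
  have : cl (restr r [set z | r (val x) z /\ r z (val y)]).
    have gxy : E (g (val x)) (g (val y)) by apply: (E_trans _ i); [exact: (valC x) | apply/E_sym; exact: (valC y)].
    apply: (@cl_sub _ _ _ ((perp (g (val x)) `|` perp (g (val y))) `|` btw (g (val x)) (g (val y))));
      last by apply: cl_setU => //; apply: cl_setU => //; exact: clperp.
    move: (val x) (val y) xy {gxy} => a b ab z [az zb].
    have [[nz1 nz2]|cz] := pselect (perp (g a) z); first by left; left.
    have [[nz1 nz2]|dz] := pselect (perp (g b) z); first by left; right.
    right; left; split.
      have [//|ngz] := pselect (r (g a) z).
      have zg : r z (g a) by apply: contrapT => nzg; apply: cz.
      by case: (gP a) => _ [->//|[_ []]]; exact: rt az zg.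
    have [//|ngz] := pselect (r z (g b)).
    have gz : r (g b) z by apply: contrapT => nzg; apply: dz.
    by case: (gP b) => _ [->//|[ngb _]]; case: ngb; exact: rt gz zb.
  have inI (z : [set z | restr r F x z /\ restr r F z y]) :
    [set z | r (val x) z /\ r z (val y)] (val (val z)) by exact: (valC z).
  apply: (@cl_embed _ _ _ _ (fun z => subt (inI z))) => //.
  by move=> u v /(congr1 val) /= /val_setI/val_setI.
have /choice[mu muP] : forall C : set T, exists m, forall y, C y -> C m.
  move=> C; have [[m Cm]|nC] := pselect (C !=set0); first by exists m.
  by exists t0 => z Cz; case: nC; exists z.
(* [mu] depends only on the set, so equivalent points get the same representative in [M], and the
   representatives form a chain. *)
pose rep x := mu [set k | M k /\ E (g x) k].
have repP x : M (rep x) /\ E (g x) (rep x).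
  by apply: (muP [set k | M k /\ E (g x) k] (g x)); split.
have rep_eq x y : rep x = rep y -> E (g x) (g y).
  by move=> e; apply: (E_trans _ (rep x)); [case: (repP x)|rewrite e; apply/E_sym; case: (repP y)].
have rep_class x y : E (g x) (g y) -> rep x = rep y.
  move=> Exy; congr mu; apply/seteqP; split=> k [Mk Ek]; split=> //; apply: E_trans Ek => //.
  exact: E_sym.
have in_rep x : range rep (rep x) by exists x.
apply: (@cl_partition _ _ _ (restr r (range rep)) (fun x => subt (in_rep x)) por).
- apply: Or33; apply: chains => _ _ /set_mem[x _ <-] /set_mem[y _ <-].
  by apply/orP; apply: Mtot; [case: (repP x)|case: (repP y)].
- move=> j; have [x0 _ x0j] := valC j.
  have inF (x : (fun x => subt (in_rep x)) @^-1` [set j]) : [set x | E (g x) (g x0)] (val x).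
    have xj : subt (in_rep (val x)) = j := valC x.
    by apply: rep_eq; rewrite x0j; exact: (f_equal (@sval _ _) xj).
  apply: (@cl_embed _ _ _ _ (fun x => subt (inF x))) (cl_block (g x0)) => //.
  by move=> u v /(congr1 val) /= /val_setI.
move=> x y rxy repN.
have nE : ~ E (g x) (g y).
  by move=> /rep_class e; apply: repN; apply: val_setI; rewrite /= e.
have [[Mx Ex] [My Ey]] := (repP x, repP y).
(* If [g y] were below [g x], the order of the representatives would put both points in one
   class. *)
have gxy : r (g x) (g y).
  have [//|gyx] := Mtot _ _ (gM x) (gM y); case: nE.
  have [xy|yx] := Mtot _ _ Mx (gM y).
    apply: (E_sub _ _ _ Ex) => z [[xz zy]|[yz zx]]; right; split=> //.
    - exact: rt (rt _ _ _ xy gyx) xz.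
    - exact: rt zy gyx.
    - exact: rt xy yz.
  apply: (E_trans _ _ _ Ex); apply: E_sym.
  apply: (E_sub _ _ _ Ey) => z [[yz zx]|[xz zy]]; left; split=> //.
  - exact: rt zx rxy.
  - exact: rt yx xz.
  - exact: rt zy (rt _ _ _ yx rxy).
(* Without such an [m], the interval from [g x] to [g y] would be covered by the classes of its
   endpoints. *)
have [m [Mm xm my nxm nmy]] :
    exists m, [/\ M m, r (g x) m, r m (g y), ~ E (g x) m & ~ E m (g y)].
  apply: contrapT => nm; apply: nE.
  apply: (@cl_sub _ _ _ ([set z | E (g z) (g x)] `|` [set z | E (g z) (g y)])); last first.
    by apply: cl_setU => //; exact: cl_block.
  move=> z bz; have [xz zy] : r (g x) z /\ r z (g y).
    by case: bz => // -[yz zx]; split; [exact: rt gxy yz | exact: rt zx gxy].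
  have xgz : r (g x) (g z).
    have [//|gzx] := Mtot _ _ (gM x) (gM z).
    by case: (gP z) => _ [->//|[ngz _]]; case: ngz; exact: rt gzx xz.
  have gzy : r (g z) (g y).
    have [//|ygz] := Mtot _ _ (gM z) (gM y).
    by case: (gP z) => _ [->//|[_ ngz]]; case: ngz; exact: rt zy ygz.
  have [|nxz] := pselect (E (g x) (g z)); first by left; apply: E_sym.
  by right; apply: contrapT => nzy; apply: nm; exists (g z); split.
(* If [x] were incomparable to [m] and to [g x], so would be everything between them; that interval
   would lie in [perp x], against the choice of [m]. The argument for [y] is dual. *)
apply: (rt m).
  have [_ [<-//|[ngx nxg]]] := gP x.
  have [//|nrxm] := pselect (r x m); have [mx|nmx] := pselect (r m x).
    by case: ngx; exact: rt xm mx.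
  case: nxm; apply: (@cl_sub _ _ _ (perp x)) (clperp x) => z bz.
  have [xz zm] : r (g x) z /\ r z m.
    by case: bz => // -[mz zx]; split; [exact: rt xm mz | exact: rt zx xm].
  by split=> [rxz|rzx]; [apply: nrxm; exact: rt rxz zm | apply: ngx; exact: rt xz rzx].
have [_ [<-//|[ngy nyg]]] := gP y.
have [//|nrmy] := pselect (r m y); have [ym|nym] := pselect (r y m).
  by case: nyg; exact: rt ym my.
case: nmy; apply: (@cl_sub _ _ _ (perp y)) (clperp y) => z bz.
have [mz zy] : r m z /\ r z (g y).
  by case: bz => // -[yz zm]; split; [exact: rt my yz | exact: rt zm my].
by split=> [ryz|rzy]; [apply: nyg; exact: rt ryz zy | apply: nrmy; exact: rt mz rzy].
Qed.

(** By [cl_perp], a subset outside the closure contains a point whose incomparable elements within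
    the subset are again outside it. Iteration produces an infinite antichain. *)
Lemma chains_cl T (r : rel T) : partial_order r -> FAC r ->
  (forall C : set T, {in C &, total r} -> G0 (restr r C)) -> cl r.
Proof.
move=> por fac chains; apply: contrapT => ncl.
pose perp y := [set z | ~ r y z /\ ~ r z y].
have [||f [f0 fN fS]] := @dependent_choice_in (set T) (fun C => ~ cl (restr r C))
  (fun C D => exists2 y, C y & D = C `&` perp y) setT.
- apply: contra_not ncl.
  by apply: (@cl_embed _ _ _ _ (fun x => subt (C := setT) (x := x) I)) => // x y /(congr1 val).
- move=> C nC; apply: contrapT => nD; apply: nC; apply: cl_perp.
  + exact: partial_order_restr.
  + exact: FAC_restr.
  + move=> D Dtot; pose D' := [set val x | x in D].
    have GD' : G0 (restr r D').
      apply: chains => _ _ /set_mem[x Dx <-] /set_mem[y Dy <-].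
      by apply: Dtot; exact: mem_set.
    have D'x (x : D) : D' (val (val x)) by exists (val x) => //; exact: valC.
    apply: (linear_class_iso (reasonable_linear G0_reasonable)) GD'.
    apply: order_iso_sym; apply: (@order_iso_surj _ _ _ _ (fun x => subt (D'x x))) => //.
      by move=> x y /(congr1 val) /= /val_setI/val_setI.
    move=> y; have [x Dx xy] := valC y.
    by exists (subt Dx); apply: val_setI.
  + move=> y; apply: contrapT => nP; apply: nD; exists (C `&` perp (val y)).
      apply: contra_not nP.
      have inP (x : [set z | ~ restr r C y z /\ ~ restr r C z y]) :
          (C `&` perp (val y)) (val (val x)).
        by split; [exact: valC | exact: (valC x)].
      apply: (@cl_embed _ _ _ _ (fun x => subt (inP x))) => //.
      by move=> u v /(congr1 val) /= /val_setI/val_setI.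
    by exists (val y) => //; exact: valC.
have /choice[y yP] : forall n, exists y, f n y /\ f n.+1 = f n `&` perp y.
  by move=> n; have [y fy fSn] := fS n; exists y.
have sub i k : f (i + k) `<=` f i.
  elim: k => [|k IH]; first by rewrite addn0.
  by rewrite addnS; have [_ ->] := yP (i + k); apply: subset_trans IH => z [].
have anti i j : i < j -> perp (y i) (y j).
  move=> ij; have [fj _] := yP j.
  have : f i.+1 (y j) by apply: (sub i.+1 (j - i.+1)); rewrite subnKC.
  by have [_ ->] := yP i => -[].
have yI i j : r (y i) (y j) -> i = j.
  by case: (ltngtP i j) => // /anti[n1 n2 rij].
apply: infinite_nat; rewrite -(preimage_range y).
apply: finite_preimage => [i j _ _ e|]; first by apply: yI; rewrite e por_refl.
by apply: fac => _ _ [i _ <-] [j _ <-] /yI->.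
Qed.

(** * Posets of the closure are alpha-FAC with chains in the base class *)

Lemma G0_fiber_sum T (r : rel T) J (rJ : rel J) (h : T -> J) :
    (forall x y, r x y -> rJ (h x) (h y)) ->
    (forall x y, rJ (h x) (h y) -> h x <> h y -> r x y) ->
    G0 rJ -> (forall j, G0 (restr r (h @^-1` [set j]))) -> G0 r.
Proof.
move=> rh hr GJ Gfib.
(* An augmentation would not suffice for [G0]; since [h] is monotone, [r] is the sum itself. *)
have e : fiber_sum r rJ h = r.
  apply/funext => x; apply/funext => y; apply/asboolP/idP => [[[]//|[]]|xy]; first exact: hr.
  by have [hxy|hxy] := pselect (h x = h y); [left|right; split=> //; exact: rh].
have := G0_sums GJ Gfib.
by apply: (linear_class_iso (reasonable_linear G0_reasonable)); rewrite -{2}e; exact: fiber_sum_iso.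
Qed.

Lemma G0_total T (r : rel T) : G0 r -> total_order r.
Proof. exact: (linear_class_total (reasonable_linear G0_reasonable)). Qed.

(** Since alpha is infinite, alpha-wqo posets are wqo and their chains are well-ordered; the
    reversed case uses closure of [G0] under reversals. *)
Lemma admissible_FAC J (rJ : rel J) : admissible rJ ->
  [/\ partial_order rJ, FAC rJ &
    forall C : set J, {in C &, total rJ} -> G0 (restr rJ C)].
Proof.
case=> [[por w]|[por w]|GJ].
- have {}w := alpha_wqo_wqo alpha_ordinal alpha_infinite w.
  split=> //; first exact: wqo_FAC.
  by move=> C Ctot; apply: G0_well_orders; exact: well_order_chain.
- have {}w := alpha_wqo_wqo alpha_ordinal alpha_infinite w.
  have facR := wqo_FAC w.
  split=> //; first by move=> C Canti; apply: facR => x y Cx Cy xy; apply/esym; exact: Canti.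
  move=> C Ctot; apply: (@reasonable_reversal _ G0_reasonable _ (restr (reversal rJ) C)).
  apply: G0_well_orders; apply: well_order_chain => //; first exact: partial_order_reversal.
  by move=> x y Cx Cy; rewrite /reversal orbC; exact: Ctot.
- have [por tot] := G0_total GJ; split=> //; last first.
    by move=> C _; exact: (reasonable_restr G0_reasonable).
  move=> C Canti; have [[x Cx]|C0] := pselect (C !=set0); last first.
    by rewrite (_ : C = set0) // -subset0 => x Cx; apply: C0; exists x.
  apply: (@sub_finite_set _ _ [set x]); last exact: finite_set1.
  move=> y Cy; case/orP: (tot x y) => xy; first by apply/esym; exact: Canti.
  exact: Canti.
Qed.

Hypothesis G_augmentations : closed_under_augmentations (alpha_FAC_chains alpha G0).

Lemma FAC_chains T (r : rel T) : partial_order r -> FAC r ->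
  (forall C : set T, {in C &, total r} -> G0 (restr r C)) -> alpha_FAC_chains alpha G0 r.
Proof.
move=> por fac chains; split=> //; apply: FAC_alpha_FAC => // C w.
by apply: wqoW => //; exact: partial_order_restr.
Qed.

Lemma cl_FAC_chains T (r : rel T) : cl r -> alpha_FAC_chains alpha G0 r.
Proof.
elim=> {T r}.
- move=> T r Gr; have [por fac chains] := admissible_FAC (Or33 _ _ Gr).
  exact: FAC_chains.
- move=> T T' r r' [f fbij fm] _ [por [fac _] chains].
  have [g fK gK] := fbij; apply: FAC_chains.
  + split; first split.
    * by move=> x; rewrite -(gK x) fm por_refl.
    * by move=> y x z; rewrite -(gK x) -(gK y) -(gK z) !fm; exact: por_trans.
    * by move=> x y; rewrite -(gK x) -(gK y) !fm => /(por_anti por)->.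
  + move=> C Canti; apply: (@sub_finite_set _ _ (f @` (f @^-1` C))).
      by move=> y Cy; exists (g y); rewrite /= gK.
    by apply: finite_image; apply: fac => x y Cx Cy xy; apply: (can_inj fK); apply: Canti; rewrite ?fm.
  + move=> C Ctot; apply: (linear_class_iso (reasonable_linear G0_reasonable) (restr_iso C fbij fm)).
    apply: chains => x y /set_mem Cx /set_mem Cy; rewrite -!fm.
    by apply: Ctot; exact: mem_set.
- move=> J rJ X rX adm _ IH.
  have [porJ facJ chainsJ] := admissible_FAC adm.
  have porX j : partial_order (rX j) by case: (IH j).
  apply: FAC_chains.
  + exact: lexsum_partial_order.
  + by apply: lexsum_FAC; [exact: por_refl | | move=> j; case: (IH j) => _ []].
  (* A chain of the sum is the sum, along the chain of its tags, of chains of the summands. *)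
  + move=> C Ctot; pose K := [set tag u | u in C].
    have Ktag (c : C) : K (tag (val c)) by exists (val c) => //; exact: valC.
    apply: (@G0_fiber_sum _ _ _ (restr rJ K) (fun c => subt (Ktag c))).
    * by move=> c d /(lexsum_tag (por_refl porJ)).
    * move=> c d cd cNd; rewrite /restr /= lexsum_diff // => e; apply: cNd.
      by apply: val_setI.
    * apply: chainsJ => _ _ /set_mem[u Cu <-] /set_mem[v Cv <-].
      have /orP[uv|vu] := Ctot u v (mem_set Cu) (mem_set Cv).
        by rewrite (lexsum_tag (por_refl porJ) uv).
      by rewrite (lexsum_tag (por_refl porJ) vu) orbT.
    * move=> j; pose D := [set x | C (existT X (val j) x)].
      have GD : G0 (restr (rX (val j)) D).
        have [_ _ chainsX] := IH (val j); apply: chainsX => x y /set_mem Dx /set_mem Dy.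
        have := Ctot _ _ (mem_set Dx) (mem_set Dy).
        by rewrite !lexsum_same.
      apply: (linear_class_iso (reasonable_linear G0_reasonable)) GD.
      have Cx (x : D) : C (existT X (val j) (val x)) := valC x.
      have fibx (x : D) : ((fun c => subt (Ktag c)) @^-1` [set j]) (subt (Cx x)).
        exact: val_setI.
      apply: (@order_iso_surj _ _ _ _ (fun x => subt (fibx x))).
      - move=> x y /(congr1 val)/(congr1 val) /= e.
        exact: val_setI (existT_inj e).
      - move=> [c cj]; have {}cj' : subt (Ktag c) = j := set_mem cj.
        case: c cj cj' => -[k x] Ckx cj cj'; have kj : k = val j := congr1 (@sval _ _) cj'.
        move: x Ckx cj cj'; rewrite kj => x Ckx cj cj'.
        have Dx : D x by exact: set_mem.
        by exists (subt Dx); apply/val_setI/val_setI.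
      - by move=> x y; rewrite /restr /= lexsum_same.
- move=> T r r' _ IH por rr'; exact: G_augmentations IH por rr'.
Qed.

End Closure.

Theorem mainTheorem11 (A : Type) (alpha : rel A) (G0 : order_class)
  (alpha_ordinal : well_order alpha)
  (alpha_countable : countable [set: A])
  (alpha_infinite : infinite_set [set: A])
  (G0_reasonable : reasonable G0)
  (G0_well_orders : forall (T : Type) (r : rel T), well_order r -> G0 T r)
  (G0_sums : closed_under_sums G0)
  (G_augmentations : closed_under_augmentations (alpha_FAC_chains alpha G0)) :
  forall (T : Type) (r : rel T),
    alpha_FAC_chains alpha G0 r <-> alpha_cl alpha G0 r.
Proof.
(* This excludes the contradictory case; from here on FAC posets are alpha-FAC. *)
have wqoW := wqo_alpha_wqo alpha_ordinal G0_well_orders G_augmentations.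
move=> T r; split=> [[por [fac _] chains]|]; first exact: chains_cl.
exact: cl_FAC_chains.
Qed.
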